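(* (a) For any $X:=\{x_i\}_{i\in[n]}$ in $\mathbb{R}^d$, any $k,s,\ell\in\mathbb{N}$ (with $2\le k\le s\le n$) and $\epsilon>0$, the random variable $B_M$ computed by the Markov Monte Carlo procedure (see context) satisfies $\operatorname{IP}(X,k)\ge B_M$ with probability at least $1-\epsilon$ (probability over the procedure's randomness). (b) Let $\mu_1,\dots,\mu_k\in\mathbb{R}^d$ be arbitrary, draw $X:=\{x_i\}_{i\in[n]}$ independently from $\mathsf{GMM}(\{(\mu_t,I_d,\frac1k)\}_{t\in[k]})$, let $s,\ell\in\mathbb{N}$, $\epsilon>0$, assume $n\ge s\ge d\ge k$, and compute $B_M$. If $s\ge 54d\log\ell$, $\ell\ge d\log(1/\epsilon)$ and $\ell\ge 3$, then \[B_M\ge\frac{d-3k-2}{d+1}\cdot\operatorname{IP}(X,k)\] with probability at least $1-e^{-s/(8d)}-2e^{-s/54}-e^{-n/(16d)}$ (probability over both $X$ and the procedure).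
   Context: For a tuple $Y=\{y_j\}_{j\in[m]}$ in $\mathbb{R}^d$, $m\ge k$: $\operatorname{IP}(Y,k):=\min_{\Gamma}\frac1m\sum_{S\in\Gamma}\sum_{j\in S}\|y_j-c_S\|^2$ over partitions $\Gamma$ of $[m]$ into $k$ nonempty sets, $c_S$ the mean of $\{y_j\}_{j\in S}$; $\operatorname{SDP}(Y,k):=\min\{\frac1{2m}\operatorname{tr}(D_YZ): Z\in\mathbb{R}^{m\times m}, Z\mathbf1=\mathbf1, \operatorname{tr}Z=k, Z\ge0\text{ entrywise}, Z\succeq0\}$ where $(D_Y)_{ij}=\|y_i-y_j\|^2$. Markov Monte Carlo procedure: draw $Y_1,\dots,Y_\ell$ independently, each consisting of $s$ points drawn uniformly from $X$ without replacement; output $B_M:=\epsilon^{1/\ell}\min_{i\in[\ell]}\operatorname{SDP}(Y_i,k)$. $x\sim\mathsf{GMM}(\{(\mu_t,I_d,\frac1k)\}_{t\in[k]})$ means: draw $T$ uniformly from $[k]$, then $x\sim\mathsf N(\mu_T,I_d)$. Logarithms are natural. *)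

(* Defs.v *)
From HB Require Import structures.
From mathcomp Require Import all_boot all_order all_algebra.
From mathcomp Require Import all_classical all_reals all_analysis.
Set Implicit Arguments. Unset Strict Implicit. Unset Printing Implicit Defensive.
Import Order.TTheory GRing.Theory Num.Theory.
Local Open Scope classical_set_scope.
Local Open Scope ring_scope.

Section Defs.
Context {R : realType}.

Definition sqnorm (d : nat) (v : 'rV[R]_d) : R := \sum_(j < d) (v ord0 j) ^+ 2.

Definition centroid (m d : nat) (Y : 'I_m -> 'rV[R]_d) (S : {set 'I_m}) : 'rV[R]_d :=
  (#|S|%:R)^-1 *: \sum_(j in S) Y j.

Definition kmeans_cost (m d : nat) (Y : 'I_m -> 'rV[R]_d) (G : {set {set 'I_m}}) : R :=
  (m%:R)^-1 * \sum_(S in G) \sum_(j in S) sqnorm (Y j - centroid Y S).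

(* IP(Y,k): minimum over partitions of [m] into k nonempty sets
   (finset's [partition] excludes the empty block). *)
Definition IP (m d : nat) (Y : 'I_m -> 'rV[R]_d) (k : nat) : R :=
  inf [set c | exists G : {set {set 'I_m}},
         (finset.partition G [set: 'I_m] && (#|G| == k)) /\ c = kmeans_cost Y G].

Definition distmx (m d : nat) (Y : 'I_m -> 'rV[R]_d) : 'M[R]_m :=
  \matrix_(i, j) sqnorm (Y i - Y j).

Definition psd (m : nat) (Z : 'M[R]_m) : Prop :=
  Z^T = Z /\ forall v : 'cV[R]_m, 0 <= (v^T *m Z *m v) ord0 ord0.

Definition SDP_feasible (m k : nat) (Z : 'M[R]_m) : Prop :=
  [/\ Z *m const_mx 1 = const_mx 1 :> 'cV[R]_m,
      \tr Z = k%:R,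
      (forall i j, 0 <= Z i j) &
      psd Z].

Definition SDP (m d : nat) (Y : 'I_m -> 'rV[R]_d) (k : nat) : R :=
  inf [set v | exists Z : 'M[R]_m,
         SDP_feasible k Z /\ v = ((2 * m)%:R)^-1 * \tr (distmx Y *m Z)].

(* Outcome of the procedure's randomness: l draws, each an ordered sample
   y_{i,1..s} = x_{w i 1}, ..., x_{w i s} of indices drawn without replacement,
   i.e. w i is an injection 'I_s -> 'I_n; the procedure draws w uniformly among
   the outcomes with every w i injective. *)
Notation samples n s l := {ffun 'I_l -> {ffun 'I_s -> 'I_n}}.

Definition valid_sample (n s l : nat) (w : samples n s l) : bool :=
  [forall i, injectiveb (w i)].

Definition subsample (n d s l : nat) (X : 'I_n -> 'rV[R]_d) (w : samples n s l)
  (i : 'I_l) : 'I_s -> 'rV[R]_d := fun j => X (w i j).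

Definition BM (n d s l : nat) (X : 'I_n -> 'rV[R]_d) (k : nat) (eps : R)
  (w : samples n s l) : R :=
  eps `^ ((l%:R)^-1) * inf (range (fun i : 'I_l => SDP (subsample X w i) k)).

Definition proc_prob (n s l : nat) (E : pred (samples n s l)) : R :=
  (#|[set w | valid_sample w && E w]|%:R) / (#|[set w : samples n s l | valid_sample w]|%:R).

Definition pr (dT : measure_display) (T : measurableType dT)
  (P : probability T R) (A : set T) : R := fine (P A).

(* Joint model for part (b) on a probability space (Omega, P):
   - T i : label of x_i, uniform on [k] ('I_k);
   - Z i j : j-th coordinate of the standard Gaussian noise of x_i, ~ N(0,1);
   - W : the procedure's randomness, uniform on valid outcomes;
   all of these mutually independent.  Then x_i = mu_{T_i} + (Z i j)_j,
   so the x_i are i.i.d. GMM({(mu_t, I_d, 1/k)}). *)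
Definition gmm_procedure_model (dT : measure_display) (Omega : measurableType dT)
  (P : probability Omega R) (n d k s l : nat)
  (T : 'I_n -> Omega -> 'I_k) (Z : 'I_n -> 'I_d -> Omega -> R)
  (W : Omega -> samples n s l) : Prop :=
      (forall i t, measurable (T i @^-1` [set t])) /\
      (forall i j, measurable_fun setT (Z i j)) /\
      (forall w, measurable (W @^-1` [set w])) /\
      (forall i t, pr P (T i @^-1` [set t]) = (k%:R)^-1) /\
      (forall i j (A : set R), measurable A ->
          P (Z i j @^-1` A) = normal_prob 0 1 A) /\
      (forall w, pr P (W @^-1` [set w]) =
          if valid_sample w
          then (#|[set w' : samples n s l | valid_sample w']|%:R)^-1 else 0) /\
      (forall (B : 'I_n -> set 'I_k) (A : 'I_n -> 'I_d -> set R)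
              (C : set (samples n s l)),
          (forall i j, measurable (A i j)) ->
          pr P ((\big[setI/setT]_(i < n) (T i @^-1` B i))
                `&` (\big[setI/setT]_(i < n) \big[setI/setT]_(j < d) (Z i j @^-1` A i j))
                `&` (W @^-1` C))
          = (\prod_(i < n) pr P (T i @^-1` B i))
            * (\prod_(i < n) \prod_(j < d) pr P (Z i j @^-1` A i j))
            * pr P (W @^-1` C)).

Definition gmm_points (Omega : Type) (n d k : nat) (mu : 'I_k -> 'rV[R]_d)
  (T : 'I_n -> Omega -> 'I_k) (Z : 'I_n -> 'I_d -> Omega -> R) (om : Omega) :
  'I_n -> 'rV[R]_d := fun i => mu (T i om) + \row_j Z i j om.

End Defs.

Notation samples n s l := {ffun 'I_l -> {ffun 'I_s -> 'I_n}}.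

(* Main.v *)
Require Import Defs.
From HB Require Import structures.
From mathcomp Require Import all_boot all_order all_algebra.
From mathcomp Require Import all_classical all_reals all_analysis.
From mathcomp Require Import perm measurable_realfun.
From mathcomp Require Import ring lra zify.
Import Order.TTheory GRing.Theory Num.Theory.
Local Open Scope classical_set_scope.
Local Open Scope ring_scope.
Set Implicit Arguments. Unset Strict Implicit. Unset Printing Implicit Defensive.

(* (a) Restricting an optimal clustering of X to a uniform sample Y (and splitting
   blocks if fewer than k of them survive) shows that SDP(Y, k) has mean at most
   IP(X, k); Markov's inequality for each of the l independent samples gives the
   factor epsilon^(1/l).

   (b) Only d > 3k + 2 matters.  Let G be the Gaussian noise of a sample and U an
   orthonormal basis of the span of the centres, of rank at most k.  A feasible Z
   satisfies 0 <= Z <= 1 and tr Z = k, so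
     s SDP(Y, k) >= |G|_F^2 - |G U^T|_F^2 - k |G|_op^2 .
   Chernoff bounds make the first two terms at least s(d - k - 1), and a grid net
   of mesh 1/50 in the unit ball makes |G|_op^2 <= 2s, for all l samples at once;
   hence SDP(Y, k) >= d - 3k - 1.  On the other hand IP(X, k) <= d + 1 by a
   Chernoff bound for the whole noise, and epsilon^(1/l) >= 1 - 1/d.  All the
   Chernoff bounds come from one moment generating function, that of
   a |g|^2 + lambda sum_q <u_q, g>^2 with orthonormal u_q. *)

(** * Gaussian moment generating functions *)

(** Two obstacles shape part (b). Which rows of noise a sample sees depends on [W], so the value w
    of [W] is fixed first: the event C = {W = w} is carried through every Gaussian estimate, each
    bound gains the factor P(W = w), and summing over w removes it. Moreover, independence is given
    only for rectangles, so joint expectations are built up from products of indicators.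

    The two Frobenius terms are estimated by one exponential moment, in which the directions of U
    cancel as many of the d coordinates of each row; what remains is the lower tail of a chi-square
    with s (d - m) degrees of freedom, m being the rank.

    Of the loss 3k, the operator norm accounts for 2k and the span of the centres for k; the further
    1 pays for the deviation, and the factor 1 - 1/d costs less than one more. The operator norm is
    the tight estimate: a net of size exponential in d has to be beaten with s >= 54 d, hence the
    fine mesh and the accurate value of ln 2. *)

Section density.
Context d1 d2 (T1 : measurableType d1) (T2 : measurableType d2) (R : realType).
Variables (mu : {measure set T1 -> \bar R}) (nu : {measure set T2 -> \bar R}).
Variables (X : T1 -> T2) (U : T1 -> R).
Hypothesis mX : measurable_fun setT X.
Hypothesis mU : measurable_fun setT U.
Hypothesis U0 : forall x, 0 <= U x.
Hypothesis nuE : forall A, measurable A ->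
  nu A = (\int[mu]_x (U x * \1_A (X x))%:E)%E.

Import HBNNSimple.

Let density_nnsfun (f : {nnsfun T2 >-> R}) :
  (\int[nu]_y (f y)%:E = \int[mu]_x (U x * f (X x))%:E)%E.
Proof.
have mfX r : measurable_fun setT (fun x => \1_(f @^-1` [set r]) (X x) : R).
  exact: (measurableT_comp (measurable_indic _) mX).
have term0 r x : (0 <= (r * \1_(f @^-1` [set r]) x)%:E)%E.
  by rewrite EFinM nnfun_muleindic_ge0.
under [LHS]eq_integral do rewrite fimfunE -fsumEFin//.
rewrite [LHS]ge0_integral_fsum//; last first.
  by move=> r; exact/measurable_EFinP/measurableT_comp.
under [RHS]eq_integral.
  move=> x xD; rewrite fimfunE EFinM -fsumEFin// ge0_mule_fsumr//.
  over.
rewrite [RHS]ge0_integral_fsum//; last 2 first.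
- move=> r; apply/measurable_EFinP/measurable_funM => //.
  exact: measurable_funM.
- by move=> n x _; rewrite mule_ge0// lee_fin.
apply: eq_fsbigr => r /[!inE] -[t _ ft].
have r0 : 0 <= r by rewrite -ft.
under eq_integral do rewrite EFinM.
under [RHS]eq_integral do rewrite -EFinM mulrCA EFinM.
rewrite !ge0_integralZl_EFin//.
- by rewrite integral_indic// setIT nuE.
- by move=> x _; rewrite lee_fin mulr_ge0.
- exact/measurable_EFinP/measurable_funM.
- exact/measurable_EFinP.
Qed.

(** Simple functions, then monotone convergence. It serves twice: with [X] the identity and [U] the
    normal density, and in [expectation_prod], where [U] is the product of all factors but one and
    [nu] is a multiple of N(0, 1). *)
Lemma integral_density (f : T2 -> R) : measurable_fun setT f ->
  (forall y, 0 <= f y) ->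
  (\int[nu]_y (f y)%:E = \int[mu]_x (U x * f (X x))%:E)%E.
Proof.
move=> mf f0.
have mEf : measurable_fun setT (EFin \o f) by exact/measurable_EFinP.
pose f_ := nnsfun_approx measurableT mEf.
have f_cvg y : (f_ n y)%:E @[n --> \oo] --> (f y)%:E.
  by apply: (@cvg_nnsfun_approx _ _ _ _ measurableT _ mEf) => // x _; rewrite lee_fin.
have f_nd y : {homo (fun n => f_ n y) : m n / (m <= n)%N >-> m <= n}.
  by move=> m n mn; exact/lefP/nd_nnsfun_approx.
transitivity (limn (fun n => \int[nu]_y (f_ n y)%:E))%E.
  rewrite -monotone_convergence//=.
  - by apply: eq_integral => y _; apply/esym/cvg_lim => //; exact: f_cvg.
  - by move=> n; exact/measurable_EFinP.
  - by move=> n y _; rewrite lee_fin.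
  - by move=> y _ m n mn; rewrite lee_fin f_nd.
under eq_fun do rewrite density_nnsfun.
rewrite -monotone_convergence//=.
- apply: eq_integral => x _; apply/cvg_lim => //.
  rewrite EFinM; under eq_fun do rewrite EFinM.
  exact: cvgeZl.
- move=> n; apply/measurable_EFinP/measurable_funM => //.
  exact: measurableT_comp.
- by move=> n y _; rewrite lee_fin mulr_ge0.
- by move=> y _ m n mn; rewrite lee_fin ler_wpM2l// f_nd.
Qed.

End density.

Section gaussian_1d.
Context {R : realType}.
Local Notation gamma := (@normal_prob R 0 1).

Lemma integral_normal01 (f : R -> R) : measurable_fun setT f ->
  (forall y, 0 <= f y) ->
  (\int[gamma]_y (f y)%:E
   = \int[lebesgue_measure]_x (normal_pdf 0 1 x * f x)%:E)%E.
Proof.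
move=> mf f0.
apply: (@integral_density _ _ (measurableTypeR R) (measurableTypeR R) R lebesgue_measure gamma id
  (normal_pdf 0 1)) => //.
- exact: measurable_normal_pdf.
- by move=> x; exact: normal_pdf_ge0.
move=> A mA; rewrite /= /normal_prob integral_mkcond; apply: eq_integral => x _.
by rewrite patchE indicE; case: ifPn => _; rewrite ?mulr1 ?mulr0.
Qed.

Lemma measurable_exp_quad (a b : R) :
  measurable_fun setT (fun x : R => expR (a * x ^+ 2 + b * x)).
Proof.
apply: measurableT_comp => //; apply: measurable_funD;
  apply: measurable_funM => //; exact: measurable_funX.
Qed.

(* Completing the square turns the integrand into a multiple of the density of
   N(b / (1 - 2a), 1 / (1 - 2a)). *)
Lemma gaussian_exp_quad (a b : R) : a < 2^-1 ->
  (\int[gamma]_x (expR (a * x ^+ 2 + b * x))%:E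
   = (Num.sqrt (1 - 2 * a)^-1 * expR (b ^+ 2 / (2 * (1 - 2 * a))))%:E)%E.
Proof.
move=> a2; have v0 : 0 < 1 - 2 * a by lra.
rewrite integral_normal01//; last exact: measurable_exp_quad.
set v := 1 - 2 * a in v0 *; set sg := Num.sqrt v^-1.
have sg0 : 0 < sg by rewrite sqrtr_gt0 invr_gt0.
have sg2 : sg ^+ 2 = v^-1 by rewrite sqr_sqrtr// invr_ge0 ltW.
have pk : normal_peak (1 : R) = sg * normal_peak sg.
  rewrite /normal_peak expr1n mul1r -mulrnAr sg2 sqrtrM ?invr_ge0 ?ltW//.
  by rewrite -/sg invfM mulrA mulfV ?mul1r// gt_eqF.
transitivity (\int[lebesgue_measure]_x ((sg * expR (b ^+ 2 / (2 * v)))%:E *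
    (normal_pdf (b / v) sg x)%:E))%E.
  apply: eq_integral => x _; rewrite -EFinM; congr (_ %:E).
  rewrite !normal_pdfE ?oner_eq0 ?gt_eqF// pk /normal_fun subr0 expr1n sg2.
  rewrite -!mulrA; congr (_ * _); rewrite [RHS]mulrCA; congr (_ * _).
  rewrite -!expRD; congr expR; rewrite /v; field.
  by rewrite gt_eqF.
rewrite ge0_integralZl_EFin//.
- by rewrite integral_normal_pdf mule1.
- by move=> x _; rewrite lee_fin normal_pdf_ge0.
- by apply/measurable_EFinP; exact: measurable_normal_pdf.
- by rewrite mulr_ge0 ?expR_ge0// ltW.
Qed.

End gaussian_1d.

Section gaussian_vector.
Context {R : realType} {dT : measure_display} {Omega : measurableType dT}.
Variables (P : probability Omega R) (I : finType) (Z : I -> Omega -> R).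
Variable C : set Omega.
Hypothesis mZ : forall i, measurable_fun setT (Z i).
Hypothesis mC : measurable C.
Local Notation gamma := (@normal_prob R 0 1).
Hypothesis Z_indep : forall A : I -> set R, (forall i, measurable (A i)) ->
  P (C `&` \bigcap_i (Z i @^-1` A i))
  = (fine (P C) * \prod_i fine (gamma (A i)))%:E.

Let prob_ge0 : 0 <= fine (P C). Proof. exact: fine_ge0. Qed.

(* Indicators are replaced one coordinate at a time: once all but the i-th
   factor are arbitrary, the i-th one is reached by [integral_density]. *)
Lemma expectation_prod (f : I -> R -> R) (m : I -> R) :
    (forall i, measurable_fun setT (f i)) -> (forall i y, 0 <= f i y) ->
    (forall i, \int[gamma]_y (f i y)%:E = (m i)%:E)%E ->
  (\int[P]_x (\1_C x * \prod_i f i (Z i x))%:E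
   = (fine (P C) * \prod_i m i)%:E)%E.
Proof.
suff main (r : seq I) : forall (f : I -> R -> R) (m : I -> R),
    (forall i, measurable_fun setT (f i)) -> (forall i y, 0 <= f i y) ->
    (forall i, \int[gamma]_y (f i y)%:E = (m i)%:E)%E ->
    (forall i, i \notin r -> exists2 A, measurable A & f i = \1_A) ->
    (\int[P]_x (\1_C x * \prod_i f i (Z i x))%:E
     = (fine (P C) * \prod_i m i)%:E)%E.
  move=> mf f0 fm; apply: (main (index_enum I)) => // i.
  by rewrite mem_index_enum.
elim: r => [|i r IH] {}f {}m mf f0 fm fr.
  have /choice[A AP] : forall i, exists A, measurable A /\ f i = \1_A.
    by move=> i; have [A mA fA] := fr i isT; exists A.
  have mE i : m i = fine (gamma (A i)).
    have := fm i; have [mA ->] := AP i.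
    by rewrite integral_indic// setIT => ->.
  rewrite (eq_bigr _ (fun i _ => mE i)).
  rewrite -Z_indep; last by move=> i; case: (AP i).
  rewrite -[X in P X]setIT -integral_indic//; last first.
    apply: measurableI => //; apply: fin_bigcap_measurable => // i _.
    by rewrite -[X in measurable X]setTI; apply: mZ => //; case: (AP i).
  apply: eq_integral => x _; congr (_ %:E); rewrite indicI; congr (_ * _).
  under eq_bigr do rewrite (proj2 (AP _)) indicE.
  rewrite indicE; case: (boolP (x \in _)) => [/set_mem xA|].
    by rewrite big1// => i _; rewrite mem_set//; exact: xA.
  move=> /negP xA; have [i Hi] : exists i, ~ A i (Z i x).
    by apply/existsNP => h; apply: xA; rewrite inE => i _; exact: h.
  by rewrite (bigD1 i)//= memNset// mul0r.
have [ir|ir] := boolP (i \in r).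
  by apply: IH => // j jr; apply: fr; rewrite inE negb_or jr andbT; apply: contraNneq jr => ->.
have m0 j : 0 <= m j by rewrite -lee_fin -fm; apply: integral_ge0 => y _; rewrite lee_fin.
pose U x := \1_C x * \prod_(j | j != i) f j (Z j x).
have mU : measurable_fun setT U.
  apply: measurable_funM; first exact: measurable_indic.
  under eq_fun do rewrite -big_filter.
  apply: measurable_prod => j _; exact: measurableT_comp.
have U0 x : 0 <= U x by rewrite mulr_ge0 ?prodr_ge0.
pose c := fine (P C) * \prod_(j | j != i) m j.
have c0 : 0 <= c by rewrite mulr_ge0// prodr_ge0.
have key A : measurable A -> mscale (NngNum c0) gamma A =
    (\int[P]_x (U x * \1_A (Z i x))%:E)%E.
  move=> mA.
  pose f' j := if j == i then \1_A else f j.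
  pose m' j := if j == i then fine (gamma A) else m j.
  have := IH f' m' _ _ _ _.
  rewrite (bigD1 i)//= {2}/m' eqxx.
  under eq_bigr => j ji do rewrite /m' (negbTE ji).
  under eq_integral => x _.
    rewrite (bigD1 i)//= {1}/f' eqxx.
    under eq_bigr => j ji do rewrite /f' (negbTE ji).
    over.
  move=> h; under [RHS]eq_integral do rewrite /U -mulrA [X in _ * X]mulrC.
  rewrite h.
  - transitivity (c%:E * gamma A)%E; first by [].
    have gA : gamma A \is a fin_num by exact: (@fin_num_measure _ _ _ gamma).
    rewrite -{1}(fineK gA) -EFinM; congr (_ %:E).
    by rewrite /c mulrAC mulrA.
  - move=> j; rewrite /f'; case: eqP => // _; exact: measurable_indic.
  - by move=> j y; rewrite /f'; case: eqP => // _; rewrite indicE.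
  - move=> j; rewrite /f' /m'; case: eqP => // _.
    by rewrite integral_indic// setIT fineK// (@fin_num_measure _ _ _ gamma).
  - move=> j jr; rewrite /f'; case: eqVneq => [_|ji]; first by exists A.
    by apply: fr; rewrite inE negb_or ji.
have := @integral_density _ _ _ (measurableTypeR R) R P
  (mscale (NngNum c0) gamma) _ _ (mZ i) mU U0 key _ (mf i) (f0 i).
rewrite ge0_integral_mscale//=; first last.
- by move=> y _; rewrite lee_fin.
- by apply/measurable_EFinP; exact: (mf i).
have -> : fine (P C) * \prod_i m i = c * m i by rewrite (bigD1 i)//= /c; ring.
rewrite fm -EFinM => ->.
apply: eq_integral => x _; congr (_ %:E); rewrite /U (bigD1 i)//=.
by rewrite -!mulrA; congr (_ * _); exact: mulrC.
Qed.

Variables (J : finType) (u : J -> I -> R).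
Hypothesis u_ortho : forall p q, \sum_i u p i * u q i = (p == q)%:R.

Let mlin (b : I -> R) : measurable_fun setT (fun x => \sum_i b i * Z i x).
Proof. by apply: measurable_sum => i; exact: measurable_funM. Qed.

Let gammaZl (k : R) (g : R -> R) : 0 <= k -> measurable_fun setT (expR \o g) ->
  (\int[gamma]_h (k%:E * (expR (g h))%:E)
   = k%:E * \int[gamma]_h (expR (g h))%:E)%E.
Proof.
by move=> k0 mg; rewrite ge0_integralZl_EFin//; exact/measurable_EFinP.
Qed.

(* A quadratic exponential is a Gaussian mixture of linear ones:
   [expR (lam * y ^+ 2)] is the mean of [expR (sqrt (2 lam) * y * h)] over a
   standard normal [h].  Hence the extra linear term [b], which is what the
   induction on [r] needs. *)
Lemma gaussian_mgf_lin (a lam : R) (r : seq J) (b : I -> R) :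
  a < 2^-1 -> 0 <= lam -> 2 * lam < 1 - 2 * a -> uniq r ->
  let c := (1 - 2 * a)^-1 in
  (\int[P]_x (\1_C x * expR (a * (\sum_i Z i x ^+ 2) + \sum_i b i * Z i x
      + lam * \sum_(q <- r) (\sum_i u q i * Z i x) ^+ 2))%:E
   = (fine (P C) * (Num.sqrt c ^+ #|I| * expR (c * (\sum_i b i ^+ 2) / 2)
      * \prod_(q <- r) (Num.sqrt (1 - 2 * c * lam)^-1 *
          expR (c ^+ 2 * lam * (\sum_i u q i * b i) ^+ 2
                / (1 - 2 * c * lam)))))%:E)%E.
Proof.
move=> a2 lam0 lam2 + c.
have v0 : 0 < 1 - 2 * a by lra.
have c0 : 0 < c by rewrite invr_gt0.
have cl : 2 * c * lam < 1.
  by rewrite (_ : _ * lam = (2 * lam) / (1 - 2 * a)) ?ltr_pdivrMr ?mul1r// /c; ring.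
elim: r b => [|q r IH] b.
  move=> _; rewrite big_nil mulr1.
  pose f i y := expR (a * y ^+ 2 + b i * y).
  pose m i := Num.sqrt c * expR (c * (b i ^+ 2) / 2).
  have := @expectation_prod f m _ _ _.
  rewrite big_split/= prodr_const -expR_sum -mulr_suml -mulr_sumr => <-.
  - apply: eq_integral => x _; rewrite big_nil mulr0 addr0 mulr_sumr -big_split.
    by rewrite expR_sum.
  - by move=> i; exact: measurable_exp_quad.
  - by move=> i y; exact: expR_ge0.
  - move=> i; rewrite gaussian_exp_quad//; congr (_ * expR _)%:E.
    by rewrite /c; field; rewrite gt_eqF.
move=> /= /andP[qr ur].
pose t := Num.sqrt (2 * lam).
have t2 : t ^+ 2 = 2 * lam by rewrite sqr_sqrtr// mulr_ge0.
pose F x := a * (\sum_i Z i x ^+ 2) + \sum_i b i * Z i x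
      + lam * \sum_(q <- r) (\sum_i u q i * Z i x) ^+ 2.
pose Y x := \sum_i u q i * Z i x.
have mF : measurable_fun setT F.
  apply: measurable_funD; first apply: measurable_funD => //.
  - apply: measurable_funM => //; apply: measurable_sum => i.
    exact: measurable_funX.
  - apply: measurable_funM => //; apply: measurable_sum => i.
    exact: measurable_funX.
have mY : measurable_fun setT Y by exact: mlin.
pose f (z : Omega * measurableTypeR R) :=
  (\1_C z.1 * expR (F z.1 + (t * Y z.1) * z.2))%:E.
have mf : measurable_fun setT f.
  apply/measurable_EFinP; apply: measurable_funM.
    exact: (measurableT_comp (measurable_indic mC) measurable_fst).
  apply: measurableT_comp => //; apply: measurable_funD.
    exact: (measurableT_comp mF measurable_fst).
  apply: measurable_funM; last exact: measurable_snd.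
  apply: measurable_funM => //.
  exact: (measurableT_comp mY measurable_fst).
have f0 z : (0 <= f z)%E by rewrite lee_fin mulr_ge0 ?expR_ge0.
transitivity (\int[P]_x \int[gamma]_h f (x, h))%E.
  apply: eq_integral => x _; rewrite /f/=.
  under eq_integral do rewrite expRD mulrA EFinM.
  rewrite gammaZl ?mulr_ge0 ?expR_ge0//; last first.
    by apply: measurableT_comp => //; exact: measurable_funM.
  have := @gaussian_exp_quad R 0 (t * Y x) ltac:(lra).
  under eq_integral do rewrite mul0r add0r.
  move=> ->; rewrite mulr0 subr0 invr1 sqrtr1 mul1r mulr1 -EFinM -mulrA -expRD.
  congr (_ * expR _)%:E; rewrite big_cons /F exprMn t2 -/(Y x).
  by field.
(* For fixed h the integrand has the form of the statement again, without q and with b + t h u_q in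
   place of b, so Tonelli makes the induction hypothesis applicable. *)
transitivity (\int[gamma]_h \int[P]_x f (x, h))%E.
  exact: (@fubini_tonelli _ _ _ (measurableTypeR R) R P gamma f mf f0).
pose K := fine (P C) * (Num.sqrt c ^+ #|I| * expR (c * (\sum_i b i ^+ 2) / 2)
      * \prod_(q <- r) (Num.sqrt (1 - 2 * c * lam)^-1 *
          expR (c ^+ 2 * lam * (\sum_i u q i * b i) ^+ 2
                / (1 - 2 * c * lam)))).
have K0 : 0 <= K.
  rewrite !mulr_ge0 ?exprn_ge0 ?expR_ge0 ?sqrtr_ge0//.
  by apply: prodr_ge0 => p _; rewrite mulr_ge0 ?sqrtr_ge0 ?expR_ge0.
(* Orthonormality enters twice: |u_q| = 1 gives |b + t h u_q|^2 = |b|^2 + 2 t h <u_q, b> + 2 lam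
   h^2, and <u_p, b + t h u_q> = <u_p, b> for p in r, so the remaining factors do not involve h. *)
transitivity (\int[gamma]_h (K%:E * (expR (c * lam * h ^+ 2 +
    (c * t * \sum_i u q i * b i) * h))%:E))%E.
  apply: eq_integral => h _; rewrite /f/=.
  have := IH (fun i => b i + t * h * u q i) ur.
  under eq_integral => x _.
    rewrite (_ : _ + _ = F x + t * Y x * h).
      over.
    have -> : \sum_i (b i + t * h * u q i) * Z i x =
        \sum_i b i * Z i x + t * h * Y x.
      rewrite /Y mulr_sumr -big_split/=; apply: eq_bigr => i _; ring.
    by rewrite /F; ring.
  move=> ->; rewrite -EFinM /K -!mulrA; congr (_ * (_ * _))%:E.
  rewrite !mulrA.
  have -> : \sum_i (b i + t * h * u q i) ^+ 2 =
      \sum_i b i ^+ 2 + 2 * t * h * (\sum_i u q i * b i) + 2 * lam * h ^+ 2.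
    rewrite -t2 (_ : t ^+ 2 * h ^+ 2 = t ^+ 2 * h ^+ 2 * \sum_i u q i * u q i).
      rewrite !mulr_sumr -!big_split/=; apply: eq_bigr => i _; ring.
    by rewrite u_ortho eqxx mulr1.
  rewrite [RHS]mulrAC -expRD; congr (expR _ * _); first by field.
  apply: eq_big_seq => p pr.
  have pq : p == q = false by apply: contraNF qr => /eqP <-.
  have -> : \sum_i u p i * (b i + t * h * u q i) =
      \sum_i u p i * b i + t * h * \sum_i u p i * u q i.
    rewrite mulr_sumr -big_split/=; apply: eq_bigr => i _; ring.
  by rewrite u_ortho pq mulr0 addr0.
rewrite gammaZl//; last exact: measurable_exp_quad.
rewrite gaussian_exp_quad; last by lra.
rewrite [in 2 * (c * lam)]mulrA.
have -> : (c * t * \sum_i u q i * b i) ^+ 2 / (2 * (1 - 2 * c * lam)) =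
    c ^+ 2 * lam * (\sum_i u q i * b i) ^+ 2 / (1 - 2 * c * lam).
  by rewrite !exprMn t2; field; lra.
by rewrite -EFinM /K big_cons; congr (_ %:E); ring.
Qed.

Lemma gaussian_mgf (a lam : R) : a < 2^-1 -> 0 <= lam -> 2 * lam < 1 - 2 * a ->
  (\int[P]_x (\1_C x * expR (a * (\sum_i Z i x ^+ 2)
      + lam * \sum_q (\sum_i u q i * Z i x) ^+ 2))%:E
   = (fine (P C) * (Num.sqrt (1 - 2 * a)^-1 ^+ #|I|
        * Num.sqrt (1 - 2 * (1 - 2 * a)^-1 * lam)^-1 ^+ #|J|))%:E)%E.
Proof.
move=> a2 lam0 lam2.
have := @gaussian_mgf_lin a lam (index_enum J) (fun=> 0) a2 lam0 lam2
  (index_enum_uniq J).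
under eq_integral => x _.
  rewrite [X in _ + X + _]big1 ?addr0; last by move=> i _; rewrite mul0r.
  over.
move=> ->; congr (_ * _)%:E.
rewrite [\sum_i _]big1 ?mulr0 ?mul0r ?expR0 ?mulr1; last by move=> i _; rewrite expr0n.
congr (_ * _); rewrite -prodr_const; apply: eq_bigr => q _.
rewrite [\sum_i _]big1; last by move=> i _; rewrite mulr0.
by rewrite expr0n/= mulr0 mul0r expR0 mulr1.
Qed.

(** Exponential Markov inequality on [C]. A negative [a] is allowed, which is how lower tails are
    reached. *)
Lemma gaussian_chernoff (a lam c : R) :
  a < 2^-1 -> 0 <= lam -> 2 * lam < 1 - 2 * a ->
  fine (P (C `&` [set x | c <= a * (\sum_i Z i x ^+ 2)
      + lam * \sum_q (\sum_i u q i * Z i x) ^+ 2]))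
  <= fine (P C) * (expR (- c) * (Num.sqrt (1 - 2 * a)^-1 ^+ #|I|
        * Num.sqrt (1 - 2 * (1 - 2 * a)^-1 * lam)^-1 ^+ #|J|)).
Proof.
move=> a2 lam0 lam2.
pose F x := a * (\sum_i Z i x ^+ 2)
      + lam * \sum_q (\sum_i u q i * Z i x) ^+ 2.
have mF : measurable_fun setT F.
  apply: measurable_funD; apply: measurable_funM => //;
    by apply: measurable_sum => i; exact: measurable_funX.
have mE : measurable [set x | c <= F x].
  rewrite (_ : mkset _ = F @^-1` `[c, +oo[%classic).
    by rewrite -[X in measurable X]setTI; exact: mF.
  by apply/seteqP; split => x /=; rewrite in_itv/= andbT.
rewrite -lee_fin fineK ?fin_num_measure//; last exact: measurableI.
rewrite mulrCA EFinM -gaussian_mgf//.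
rewrite -[X in P X]setIT -integral_indic//; last exact: measurableI.
have mCF : measurable_fun setT (fun x => \1_C x * expR (F x)).
  apply: measurable_funM; first exact: measurable_indic.
  exact: measurableT_comp.
rewrite -ge0_integralZl_EFin ?expR_ge0//; last exact/measurable_EFinP.
apply: ge0_le_integral => //.
- by apply/measurable_EFinP; apply: measurable_indic; exact: measurableI.
- by apply/measurable_EFinP; exact: measurable_funM.
move=> x _; rewrite -EFinM lee_fin indicI mulrCA ler_wpM2l//.
rewrite -expRD -/(F x) indicE; case: (boolP (x \in _)) => [/set_mem/= h|_].
  by rewrite -[leLHS]expR0 ler_expR addrC subr_ge0.
exact: expR_ge0.
Qed.

End gaussian_vector.

(** * Positive semidefinite matrices *)

Section quadratic_forms.
Context {R : realType}.

Lemma mxtrace_mul_tr (m n : nat) (A : 'M[R]_(m, n)) :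
  \tr (A *m A^T) = \sum_i \sum_j A i j ^+ 2.
Proof.
apply: eq_bigr => i _; rewrite mxE; apply: eq_bigr => j _.
by rewrite mxE expr2.
Qed.

Lemma mxtrace_mul_tr_ge0 (m n : nat) (A : 'M[R]_(m, n)) : 0 <= \tr (A *m A^T).
Proof.
by rewrite mxtrace_mul_tr; do 2 apply: sumr_ge0 => ? _; exact: sqr_ge0.
Qed.

Lemma mxtrace_mul_tr_row (m n : nat) (A : 'M[R]_(m, n)) :
  \tr (A *m A^T) = \sum_i sqnorm (row i A).
Proof.
rewrite mxtrace_mul_tr; apply: eq_bigr => i _.
by apply: eq_bigr => j _; rewrite mxE.
Qed.

Lemma sqnorm_ge0 (d : nat) (v : 'rV[R]_d) : 0 <= sqnorm v.
Proof. by apply: sumr_ge0 => j _; exact: sqr_ge0. Qed.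

Lemma sqnormE (d : nat) (v : 'rV[R]_d) : sqnorm v = (v *m v^T) ord0 ord0.
Proof. by rewrite mxE; apply: eq_bigr => j _; rewrite mxE expr2. Qed.

Lemma sqnorm0_eq (d : nat) (v : 'rV[R]_d) : sqnorm v = 0 -> v = 0.
Proof.
move=> /eqP; rewrite psumr_eq0 => [/allP h|j _]; last exact: sqr_ge0.
apply/rowP => j; rewrite mxE; apply/eqP; rewrite -sqrf_eq0.
by apply: (implyP (h j _)) => //; rewrite mem_index_enum.
Qed.

Lemma sqnormZ (d : nat) (a : R) (v : 'rV[R]_d) :
  sqnorm (a *: v) = a ^+ 2 * sqnorm v.
Proof.
by rewrite /sqnorm mulr_sumr; apply: eq_bigr => j _; rewrite mxE exprMn.
Qed.

(** The test vector (- a^-1 b v, v) minimises the form over its first coordinate, and the minimum is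
    the form of the Schur complement at v. *)
Lemma psd_schur (n : nat) (a : R) (b : 'rV[R]_n) (C : 'M[R]_n) : 0 < a ->
  psd (block_mx a%:M b b^T C) -> psd (C - a^-1 *: (b^T *m b)).
Proof.
move=> a0 [+ hpos]; rewrite tr_block_mx => /eq_block_mx[_ _ _ CT].
split; first by rewrite linearB/= linearZ/= trmx_mul trmxK CT.
move=> v; pose x : 'M[R]_1 := - a^-1 *: (b *m v).
have := hpos (col_mx x v).
rewrite tr_col_mx mul_row_block mul_row_col.
set y := (b *m v) ord0 ord0.
have bvE : b *m v = y%:M by rewrite [LHS]mx11_scalar.
have vbE : v^T *m b^T = y%:M by rewrite -trmx_mul bvE tr_scalar_mx.
have xE : x = (- a^-1 * y)%:M by rewrite /x bvE scale_scalar_mx.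
rewrite !mulmxDl xE tr_scalar_mx.
rewrite -!mulmxA (mulmxA v^T b^T) vbE bvE -!scalar_mxM.
rewrite mulmxBl mulmxBr -scalemxAl -scalemxAr -!mulmxA bvE.
rewrite (mulmxA v^T b^T) vbE -!scalar_mxM.
set q := v^T *m (C *m v).
rewrite !mxE eqxx !mulr1n => h; apply: le_trans h _.
rewrite le_eqVlt; apply/orP; left; apply/eqP; field.
by rewrite gt_eqF.
Qed.

(** With a zero corner the form at (t, v) is affine in t with slope 2 <b, v>; if b were nonzero, v =
    b and a suitable t would give the value -1. *)
Lemma psd_corner0 (n : nat) (b : 'rV[R]_n) (C : 'M[R]_n) :
  psd (block_mx (0 : R)%:M b b^T C) -> b = 0 /\ psd C.
Proof.
move=> [+ hpos]; rewrite tr_block_mx => /eq_block_mx[_ _ _ CT].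
have form (t : R) (v : 'cV[R]_n) :
    0 <= 2 * t * (b *m v) ord0 ord0 + (v^T *m C *m v) ord0 ord0.
  have := hpos (col_mx t%:M v).
  rewrite tr_col_mx mul_row_block mul_row_col tr_scalar_mx.
  set y := (b *m v) ord0 ord0.
  have bvE : b *m v = y%:M by rewrite [LHS]mx11_scalar.
  have vbE : v^T *m b^T = y%:M by rewrite -trmx_mul bvE tr_scalar_mx.
  rewrite !mulmxDl -!mulmxA bvE (mulmxA v^T b^T) vbE -!scalar_mxM.
  set q := v^T *m (C *m v).
  rewrite !mxE eqxx !mulr1n => h; apply: le_trans h _.
  by rewrite le_eqVlt; apply/orP; left; apply/eqP; ring.
split; last first.
  by split=> // v; have := form 0 v; rewrite mulr0 mul0r add0r.
apply: sqnorm0_eq; apply/eqP; rewrite eq_le sqnorm_ge0 andbT leNgt; apply/negP => bpos.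
set q := (b^T^T *m C *m b^T) ord0 ord0.
have := form (- (q + 1) / (2 * sqnorm b)) b^T.
rewrite -sqnormE -/q.
have -> : 2 * (- (q + 1) / (2 * sqnorm b)) * sqnorm b + q = -1.
  by field; rewrite gt_eqF.
by rewrite lerNr oppr0 ler10.
Qed.

(** A Cholesky factorisation by induction on the size: a zero pivot has a zero row, a positive one
    is eliminated by the Schur complement. It takes the place of a spectral decomposition in the
    trace bounds. *)
Lemma psd_factor (n : nat) (Z : 'M[R]_n) : psd Z ->
  exists B : 'M[R]_n, Z = B *m B^T.
Proof.
elim: n Z => [|n IH] Z; first by exists 0; apply/matrixP => -[].
rewrite -[n.+1]/(1 + n)%N in Z *.
rewrite -[Z]submxK; set b := ursubmx Z; set C := drsubmx Z.
move=> Zpsd; have [+ _] := Zpsd.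
rewrite tr_block_mx => /eq_block_mx[_ bE _ _].
have dlE : dlsubmx Z = b^T by rewrite -[LHS]trmxK bE.
have ulE := mx11_scalar (ulsubmx Z); set a := ulsubmx Z ord0 ord0 in ulE.
rewrite dlE ulE in Zpsd *.
have a0 : 0 <= a.
  have := Zpsd.2 (col_mx 1%:M 0).
  rewrite tr_col_mx mul_row_block mul_row_col !trmx0 !mul0mx !mulmx0 !addr0.
  by rewrite tr_scalar_mx mul1mx mulmx1 mxE eqxx.
have [a0'|apos] := eqVneq a 0.
  rewrite a0' in Zpsd *; have [b0 Cpsd] := psd_corner0 Zpsd.
  have [B CE] := IH _ Cpsd; exists (block_mx 0 0 0 B).
  rewrite tr_block_mx mulmx_block b0 !trmx0 !mul0mx !mulmx0 !addr0 add0r CE.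
  by rewrite raddf0.
have {a0} apos : 0 < a by rewrite lt_def apos.
have [B CE] := IH _ (psd_schur apos Zpsd).
pose r := Num.sqrt a.
have r0 : r != 0 by rewrite gt_eqF// sqrtr_gt0.
have r2 : r * r = a by rewrite -expr2 sqr_sqrtr// ltW.
exists (block_mx r%:M 0 (r^-1 *: b^T) B).
rewrite tr_block_mx mulmx_block !trmx0 tr_scalar_mx !mul0mx !mulmx0 !addr0.
rewrite -scalar_mxM r2 linearZ/= trmxK mul_scalar_mx mul_mx_scalar !scalerA.
rewrite mulfV// !scale1r -scalemxAl -scalemxAr scalerA -CE -invfM r2.
by rewrite addrC subrK.
Qed.

Lemma psd_mxtrace_ge0 (m n : nat) (Z : 'M[R]_m) (A : 'M[R]_(m, n)) :
  psd Z -> 0 <= \tr (Z *m (A *m A^T)).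
Proof.
move=> /psd_factor[B ->]; rewrite -mulmxA mxtrace_mulC -!mulmxA (mulmxA B^T).
by rewrite -[X in _ *m X](trmxK (A^T *m B)) trmx_mul trmxK mxtrace_mul_tr_ge0.
Qed.

(** With Z = B B^T the left side is the sum of |b A|^2 over the columns b of B, and tr Z is the sum
    of |b|^2. *)
Lemma psd_mxtrace_le (m n : nat) (Z : 'M[R]_m) (A : 'M[R]_(m, n)) (K : R) :
  psd Z -> (forall v : 'rV[R]_m, sqnorm (v *m A) <= K * sqnorm v) ->
  \tr (Z *m (A *m A^T)) <= K * \tr Z.
Proof.
move=> /psd_factor[B ->] AK.
have -> : \tr (B *m B^T *m (A *m A^T)) = \tr ((B^T *m A) *m (B^T *m A)^T).
  by rewrite trmx_mul trmxK -!mulmxA mxtrace_mulC !mulmxA.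
have -> : \tr (B *m B^T) = \tr (B^T *m B^T^T) by rewrite trmxK mxtrace_mulC.
rewrite !mxtrace_mul_tr_row.
by rewrite mulr_sumr; apply: ler_sum => i _; rewrite row_mul AK.
Qed.

(* |v A|^2 = <v, (v A) A^T> is bounded by AM-GM, with weights chosen so that
   half of |v A|^2 can be absorbed. *)
Lemma opnorm_tr (m n : nat) (A : 'M[R]_(m, n)) (K : R) : 0 < K ->
  (forall u : 'rV[R]_n, sqnorm (u *m A^T) <= K * sqnorm u) ->
  forall v : 'rV[R]_m, sqnorm (v *m A) <= K * sqnorm v.
Proof.
move=> K0 AK v; set x := v *m A; have hx := AK x.
have : sqnorm x <= (K * sqnorm v + sqnorm (x *m A^T) / K) / 2.
  have -> : sqnorm x = \sum_j v ord0 j * (x *m A^T) ord0 j.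
    rewrite sqnormE [in x^T]/x trmx_mul mulmxA mxE.
    by apply: eq_bigr => j _; rewrite [_^T _ _]mxE mulrC.
  rewrite /sqnorm mulr_sumr mulr_suml -big_split/= mulr_suml.
  apply: ler_sum => j _; set p := v _ _; set q := (_ *m _) _ _.
  rewrite -subr_ge0 (_ : _ - _ = (K * p - q) ^+ 2 / (2 * K)).
    by rewrite divr_ge0 ?sqr_ge0 ?mulr_ge0 ?ltW.
  by field; rewrite gt_eqF.
have : sqnorm (x *m A^T) / K <= sqnorm x by rewrite ler_pdivrMr// mulrC.
lra.
Qed.

(** Gram-Schmidt on the rows; a row already in the span adds nothing, hence m <= k. The last clause
    places the rows of [M] in the row space of [U]. *)
Lemma orthonormal_span (k d : nat) (M : 'M[R]_(k, d)) :
  exists m (U : 'M[R]_(m, d)),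
    [/\ (m <= k)%N, U *m U^T = 1%:M & M *m U^T *m U = M].
Proof.
elim: k M => [|k IH] M.
  by exists 0%N, 0; split=> //; apply/matrixP => -[].
rewrite -[k.+1]/(1 + k)%N in M *.
rewrite -[M]vsubmxK; set v := usubmx M; set M' := dsubmx M.
have [m [U [mk UU MU]]] := IH M'.
pose r := v - v *m U^T *m U.
have rU : r *m U^T = 0 by rewrite mulmxBl -(mulmxA (v *m U^T)) UU mulmx1 subrr.
have Ur : U *m r^T = 0 by rewrite -[LHS]trmxK trmx_mul trmxK rU trmx0.
have [r0|r0] := eqVneq r 0.
  exists m, U; split=> //; first exact: leq_trans mk (leqnSn _).
  by rewrite !mul_col_mx MU; congr col_mx; apply/esym/eqP; rewrite -subr_eq0 -/r r0.
have nr : 0 < sqnorm r.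
  by rewrite lt_def sqnorm_ge0 andbT; apply: contra r0 => /eqP/sqnorm0_eq ->.
pose t := Num.sqrt (sqnorm r).
have t0 : t != 0 by rewrite gt_eqF// sqrtr_gt0.
have t2 : t * t = sqnorm r by rewrite -expr2 sqr_sqrtr// ltW.
have rr : r *m r^T = (sqnorm r)%:M by rewrite [LHS]mx11_scalar -sqnormE.
pose e : 'rV[R]_d := t^-1 *: r.
have eT : e^T = t^-1 *: r^T by rewrite linearZ.
exists (1 + m)%N, (col_mx e U); split; first by rewrite ltnS.
  rewrite tr_col_mx mul_col_row scalar_mx_block eT /e -!scalemxAl -!scalemxAr.
  rewrite rr rU Ur UU !scaler0 scalerA scale_scalar_mx; congr block_mx.
  by rewrite -t2; congr (_ %:M); field.
rewrite -mulmxA tr_col_mx mul_row_col !mul_col_mx; congr col_mx.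
  rewrite mulmxDr !mulmxA eT /e -!scalemxAr -!scalemxAl scalerA.
  have -> : v *m r^T = (sqnorm r)%:M.
    by rewrite -rr {2}/r mulmxBl -!mulmxA Ur !mulmx0 subr0.
  rewrite mul_scalar_mx scalerA (_ : _ * _ = 1); last by rewrite -t2; field.
  by rewrite scale1r /r subrK.
rewrite mulmxDr !mulmxA MU.
have -> : M' *m e^T = 0 by rewrite -MU -mulmxA eT -scalemxAr Ur scaler0 mulmx0.
by rewrite mul0mx add0r.
Qed.

End quadratic_forms.

(** * The k-means integer program and its relaxation *)

Section kmeans.
Context {R : realType}.

Lemma kmeans_cost_ge0 (m d : nat) (Y : 'I_m -> 'rV[R]_d) G :
  0 <= kmeans_cost Y G.
Proof.
rewrite mulr_ge0 ?invr_ge0//; apply: sumr_ge0 => S _; apply: sumr_ge0 => j _.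
exact: sqnorm_ge0.
Qed.

Lemma IP_ge0 (m d : nat) (Y : 'I_m -> 'rV[R]_d) k : 0 <= IP Y k.
Proof.
rewrite /IP; set A := mkset _.
(* If no partition into [k] blocks exists, the infimum over the empty set is 0. *)
have [[c Ac]|/set0P/negP/negPn/eqP ->] := pselect (A !=set0); last by rewrite inf0.
apply: lb_le_inf; first by exists c.
by move=> _ [G [_ ->]]; exact: kmeans_cost_ge0.
Qed.

Lemma IP_le (m d : nat) (Y : 'I_m -> 'rV[R]_d) (G : {set {set 'I_m}}) :
  finset.partition G [set: 'I_m] -> IP Y #|G| <= kmeans_cost Y G.
Proof.
move=> PG; apply: ge_inf; last by exists G; rewrite PG eqxx.
by exists 0 => _ [G' [_ ->]]; exact: kmeans_cost_ge0.
Qed.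

(** The parallel axis identity, checked coordinate by coordinate. *)
Lemma sum_sqdist (m d : nat) (Y : 'I_m -> 'rV[R]_d) (S : {set 'I_m})
    (c : 'rV[R]_d) : (0 < #|S|)%N ->
  \sum_(j in S) sqnorm (Y j - c) =
  \sum_(j in S) sqnorm (Y j) - #|S|%:R * sqnorm (centroid Y S)
  + #|S|%:R * sqnorm (centroid Y S - c).
Proof.
move=> S0; rewrite /sqnorm.
rewrite !mulr_sumr exchange_big/= [X in _ = X - _ + _]exchange_big/=.
rewrite -sumrB -big_split/=; apply: eq_bigr => p _; rewrite !mxE summxE.
have -> : \sum_(j in S) (Y j - c) ord0 p ^+ 2 =
    \sum_(j in S) Y j ord0 p ^+ 2 - 2 * c ord0 p * (\sum_(j in S) Y j ord0 p)
    + #|S|%:R * c ord0 p ^+ 2.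
  rewrite -sum1_card natr_sum mulr_suml mulr_sumr -sumrB -big_split/=.
  by apply: eq_bigr => j _; rewrite !mxE; ring.
by field; rewrite pnatr_eq0 -lt0n.
Qed.

Lemma centroid_min (m d : nat) (Y : 'I_m -> 'rV[R]_d) (S : {set 'I_m})
    (c : 'rV[R]_d) : (0 < #|S|)%N ->
  \sum_(j in S) sqnorm (Y j - centroid Y S) <= \sum_(j in S) sqnorm (Y j - c).
Proof.
move=> S0; rewrite !(sum_sqdist _ _ S0) lerD2l subrr.
have -> : sqnorm (0 : 'rV[R]_d) = 0.
  by rewrite /sqnorm big1// => p _; rewrite mxE expr0n.
by rewrite mulr0 mulr_ge0 ?sqnorm_ge0.
Qed.

(* Every unused label is given to one of two points that share a label, which
   exist as long as there are at least as many points as labels. *)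
Lemma refine_labelling (m k : nat) (f : 'I_m -> 'I_k) : (k <= m)%N ->
  exists g : 'I_m -> 'I_k,
    (forall c, exists i, g i = c) /\ (forall i j, g i = g j -> f i = f j).
Proof.
move=> km.
suff main n : forall g : 'I_m -> 'I_k,
    (#|~: [set g i | i : 'I_m]| <= n)%N -> (forall i j, g i = g j -> f i = f j) ->
    exists g : 'I_m -> 'I_k,
    (forall c, exists i, g i = c) /\ (forall i j, g i = g j -> f i = f j).
  by apply: (main _ f (leqnn _)).
elim: n => [|n IH] g gn gf.
  exists g; split=> // c; move: gn; rewrite leqn0 cards_eq0 => /eqP g0.
  have : c \notin ~: [set g i | i : 'I_m] by rewrite g0 inE.
  by rewrite inE negbK => /imsetP[i _ ->]; exists i.
have [g0|[c cg]] := set_0Vmem (~: [set g i | i : 'I_m]).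
  by apply: (IH g) => //; rewrite g0 cards0.
have cNg i : g i != c.
  by move: cg; rewrite inE; apply: contraNneq => <-; apply: imset_f.
have : ~ injective g.
  move=> ginj; have := cardsC [set g i | i : 'I_m].
  rewrite card_imset// !card_ord => e; have : (0 < #|~: [set g i | i : 'I_m]|)%N.
    by apply/card_gt0P; exists c.
  by rewrite lt0n => /negP; apply; move: e km; lia.
move=> /injectiveP/injectivePn[x [y xy gxy]].
pose g' z := if z == x then c else g z.
apply: (IH g'); last first.
  move=> i j; rewrite /g'; case: eqP => [->|_]; case: eqP => [->|_] //.
  - by move=> e; have := cNg j; rewrite e eqxx.
  - by move=> e; have := cNg i; rewrite e eqxx.
  - exact: gf.
rewrite -ltnS (leq_trans _ gn)//; apply: proper_card; apply/properP; split.
  apply/fintype.subsetP => e; rewrite !inE; apply: contra => /imsetP[i _ ->].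
  have [->|ix] := eqVneq i x.
    by apply/imsetP; exists y => //; rewrite /g' eq_sym (negbTE xy).
  by apply/imsetP; exists i => //; rewrite /g' (negbTE ix).
exists c => //; rewrite inE negbK; apply/imsetP; exists x => //.
by rewrite /g' eqxx.
Qed.

Lemma labelling_partition (m k : nat) (g : 'I_m -> 'I_k) :
  (forall c, exists i, g i = c) ->
  let G := [set [set i | g i == c] | c : 'I_k]%SET in
  finset.partition G [set: 'I_m] /\ #|G| = k.
Proof.
move=> gs G; split; last first.
  rewrite card_imset ?card_ord// => c c' /setP e; have [i gi] := gs c.
  by have := e i; rewrite !inE gi eqxx => /esym/eqP.
apply/and3P; split.
- apply/eqP/setP => i; rewrite inE; apply/bigcupP.
  by exists [set j | g j == g i]%SET; [apply: imset_f|rewrite inE].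
- apply/finset.trivIsetP => _ _ /imsetP[c _ ->] /imsetP[c' _ ->] cc'.
  rewrite -finset.setI_eq0; apply/eqP/setP => i; rewrite !inE.
  apply/negP => /andP[/eqP gi /eqP gi']; move: cc'.
  by rewrite -gi -gi' eqxx.
- apply/imsetP => -[c _ /setP e]; have [i gi] := gs c.
  by have := e i; rewrite !inE gi eqxx.
Qed.

(** Each block of the refined labelling carries a single label of [f], and its centroid does at
    least as well as the centre of that label. This yields the upper bounds on [IP] and on [SDP],
    and the nonemptiness of the sets they minimise over. *)
Lemma partition_of_labelling (m d k : nat) (Y : 'I_m -> 'rV[R]_d)
    (f : 'I_m -> 'I_k) (c : 'I_k -> 'rV[R]_d) : (k <= m)%N ->
  exists G : {set {set 'I_m}}, [/\ finset.partition G [set: 'I_m], #|G| = k &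
    kmeans_cost Y G <= m%:R^-1 * \sum_j sqnorm (Y j - c (f j))].
Proof.
move=> km; have [g [gs gf]] := refine_labelling f km.
have [PG Gk] := labelling_partition gs; set G := imset _ _ in PG Gk.
exists G; split=> //; rewrite ler_wpM2l ?invr_ge0//.
have -> : \sum_j sqnorm (Y j - c (f j)) =
    \sum_(S in G) \sum_(j in S) sqnorm (Y j - c (f j)).
  by rewrite -(set_partition_big _ PG); apply: eq_bigl => j; rewrite inE.
apply: ler_sum => _ /imsetP[a _ ->]; have [i gi] := gs a.
have -> : \sum_(j in [set i | g i == a]%SET) sqnorm (Y j - c (f j)) =
    \sum_(j in [set i | g i == a]%SET) sqnorm (Y j - c (f i)).
  by apply: eq_bigr => j; rewrite inE => /eqP gj; rewrite (gf j i)// gj gi.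
by apply: centroid_min; apply/card_gt0P; exists i; rewrite inE gi.
Qed.

Lemma IP_le_labelling (m d k : nat) (Y : 'I_m -> 'rV[R]_d)
    (f : 'I_m -> 'I_k) (c : 'I_k -> 'rV[R]_d) : (k <= m)%N ->
  IP Y k <= m%:R^-1 * \sum_j sqnorm (Y j - c (f j)).
Proof.
move=> km; have [G [PG <- le_cost]] := partition_of_labelling Y f c km.
exact: le_trans (IP_le Y PG) le_cost.
Qed.

Definition points_mx (m d : nat) (Y : 'I_m -> 'rV[R]_d) : 'M[R]_(m, d) :=
  \matrix_i Y i.

(** In the expansion of |y_i - y_j|^2 each of the two squares contributes |Y|_F^2, because the rows
    and the columns of [Z] sum to 1. *)
Lemma sdp_valueE (m d k : nat) (Y : 'I_m -> 'rV[R]_d) (Z : 'M[R]_m) :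
  SDP_feasible k Z ->
  ((2 * m)%:R)^-1 * \tr (distmx Y *m Z) =
  m%:R^-1 * (\tr (points_mx Y *m (points_mx Y)^T)
             - \tr (Z *m (points_mx Y *m (points_mx Y)^T))).
Proof.
case=> [Z1 _ _ [ZT _]].
have rowZ i : \sum_j Z i j = 1.
  have := congr1 (fun A : 'cV[R]_m => A i ord0) Z1; rewrite !mxE => <-.
  by apply: eq_bigr => j _; rewrite mxE mulr1.
have symZ i j : Z i j = Z j i by rewrite -[in LHS]ZT mxE.
have colZ j : \sum_i Z i j = 1.
  by under eq_bigr do rewrite symZ; exact: rowZ.
suff -> : \tr (distmx Y *m Z) = 2 * (\tr (points_mx Y *m (points_mx Y)^T)
             - \tr (Z *m (points_mx Y *m (points_mx Y)^T))).
  by rewrite natrM invfM mulrACA mulVf ?mul1r ?pnatr_eq0.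
rewrite mxtrace_mul_tr_row.
have -> : \sum_i sqnorm (row i (points_mx Y)) = \sum_i sqnorm (Y i).
  by apply: eq_bigr => i _; rewrite rowK.
have -> : \tr (distmx Y *m Z) = \sum_i \sum_j Z j i * sqnorm (Y i - Y j).
  apply: eq_bigr => i _; rewrite mxE; apply: eq_bigr => j _.
  by rewrite mxE mulrC.
have -> : \tr (Z *m (points_mx Y *m (points_mx Y)^T)) =
    \sum_i \sum_j Z j i * (\sum_p Y i ord0 p * Y j ord0 p).
  apply: eq_bigr => i _; rewrite mxE; apply: eq_bigr => j _.
  rewrite symZ !mxE; congr (_ * _); apply: eq_bigr => p _.
  by rewrite !mxE mulrC.
have dE i j : Z j i * sqnorm (Y i - Y j) = Z j i * sqnorm (Y i)
    + Z j i * sqnorm (Y j) - 2 * (Z j i * \sum_p Y i ord0 p * Y j ord0 p).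
  have -> : sqnorm (Y i - Y j) = sqnorm (Y i) + sqnorm (Y j)
      - 2 * \sum_p Y i ord0 p * Y j ord0 p.
    rewrite /sqnorm mulr_sumr -big_split/= -sumrB.
    by apply: eq_bigr => p _; rewrite !mxE; ring.
  by ring.
under eq_bigr do (under eq_bigr do rewrite dE; rewrite sumrB big_split/=
  -mulr_suml colZ mul1r -mulr_sumr).
rewrite sumrB big_split/= -mulr_sumr [X in _ + X - _]exchange_big/=.
have -> : \sum_j \sum_i Z j i * sqnorm (Y j) = \sum_i sqnorm (Y i).
  by apply: eq_bigr => i _; rewrite -mulr_suml rowZ mul1r.
ring.
Qed.

(** This is Z <= 1 tested on A A^T: for a symmetric [Z] with nonnegative entries and unit row sums
    it follows termwise from x y <= (x^2 + y^2) / 2. *)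
Lemma SDP_feasible_le1 (m k n : nat) (Z : 'M[R]_m) (A : 'M[R]_(m, n)) :
  SDP_feasible k Z -> \tr (Z *m (A *m A^T)) <= \tr (A *m A^T).
Proof.
case=> [Z1 _ Z0 [ZT _]].
have rowZ i : \sum_j Z i j = 1.
  have := congr1 (fun A : 'cV[R]_m => A i ord0) Z1; rewrite !mxE => <-.
  by apply: eq_bigr => j _; rewrite mxE mulr1.
have symZ i j : Z i j = Z j i by rewrite -[in LHS]ZT mxE.
rewrite mxtrace_mul_tr.
have -> : \tr (Z *m (A *m A^T)) = \sum_i \sum_j \sum_p Z i j * (A j p * A i p).
  apply: eq_bigr => i _; rewrite mxE; apply: eq_bigr => j _.
  by rewrite mxE mulr_sumr; apply: eq_bigr => p _; rewrite mxE.
apply: (@le_trans _ _ (\sum_i \sum_j \sum_p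
    (Z i j * A i p ^+ 2 / 2 + Z i j * A j p ^+ 2 / 2))).
  do 3 apply: ler_sum => ? _.
  rewrite -mulrDl -mulrDr -mulrA; apply: ler_wpM2l => //.
  set x := A _ _; set y := A _ _.
  have := sqr_ge0 (x - y); rewrite sqrrB -mulr_natr; lra.
under eq_bigr do (under eq_bigr do rewrite big_split/=; rewrite big_split/=).
rewrite big_split/= [X in _ + X]exchange_big/=.
have eqh : \sum_i \sum_j \sum_p Z i j * A i p ^+ 2 / 2 =
    (\sum_i \sum_p A i p ^+ 2) / 2.
  rewrite mulr_suml; apply: eq_bigr => i _; rewrite exchange_big/= mulr_suml.
  by apply: eq_bigr => p _; rewrite -!mulr_suml rowZ mul1r.
rewrite eqh.
have -> : \sum_j \sum_i \sum_p Z i j * A j p ^+ 2 / 2 =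
    (\sum_i \sum_p A i p ^+ 2) / 2.
  rewrite -eqh; do 2 apply: eq_bigr => ? _; apply: eq_bigr => p _.
  by rewrite symZ.
by rewrite -splitr.
Qed.

Lemma SDP_feasible_value_ge0 (m d k : nat) (Y : 'I_m -> 'rV[R]_d) (Z : 'M[R]_m) :
  SDP_feasible k Z -> 0 <= ((2 * m)%:R)^-1 * \tr (distmx Y *m Z).
Proof.
move=> fZ; rewrite (sdp_valueE Y fZ) mulr_ge0 ?invr_ge0// subr_ge0.
exact: SDP_feasible_le1 fZ.
Qed.

(** For a partition, the orthogonal projection onto the span of the block indicators. *)
Definition cluster_mx (m : nat) (G : {set {set 'I_m}}) : 'M[R]_m :=
  \sum_(S in G) #|S|%:R^-1 *:
    ((\col_i (i \in S)%:R) *m (\col_i (i \in S)%:R : 'cV[R]_m)^T).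

Lemma cluster_mx_trace (m n : nat) (G : {set {set 'I_m}}) (A : 'M[R]_(m, n)) :
  \tr (cluster_mx G *m (A *m A^T)) =
  \sum_(S in G) #|S|%:R^-1 * sqnorm (\sum_(i in S) row i A).
Proof.
rewrite /cluster_mx mulmx_suml raddf_sum/=; apply: eq_bigr => S _.
rewrite -scalemxAl mxtraceZ; congr (_ * _).
set e : 'cV[R]_m := \col_i _.
have -> : \tr (e *m e^T *m (A *m A^T)) = \tr ((e^T *m A) *m (e^T *m A)^T).
  by rewrite trmx_mul trmxK -!mulmxA mxtrace_mulC !mulmxA.
rewrite mxtrace_mul_tr_row big_ord1; congr sqnorm.
apply/rowP => p; rewrite !mxE summxE [RHS]big_mkcond/=; apply: eq_bigr => i _.
by rewrite !mxE; case: ifP => _; rewrite ?mul1r ?mul0r.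
Qed.

Lemma cluster_mx_feasible (m : nat) (G : {set {set 'I_m}}) :
  finset.partition G [set: 'I_m] -> SDP_feasible #|G| (cluster_mx G).
Proof.
move=> PG.
have G0 S : S \in G -> (0 < #|S|)%N.
  move=> SG; rewrite card_gt0; apply: contraTneq SG => ->.
  by case/and3P: PG.
have ZE i j : cluster_mx G i j =
    \sum_(S in G) #|S|%:R^-1 * ((i \in S)%:R * (j \in S)%:R).
  rewrite /cluster_mx summxE; apply: eq_bigr => S _.
  by rewrite !mxE big_ord1 !mxE.
have sumS (S : {set 'I_m}) : \sum_j (j \in S)%:R = #|S|%:R :> R.
  by rewrite -sum1_card natr_sum [RHS]big_mkcond/=; apply: eq_bigr => j _; case: ifP.
split.
- apply/colP => i; rewrite !mxE.
  under eq_bigr do rewrite mxE mulr1 ZE.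
  rewrite exchange_big/=.
  transitivity (\sum_(S in G) ((i \in S)%:R : R)).
    apply: eq_bigr => S /G0 S0; rewrite -!mulr_sumr sumS mulrCA.
    by rewrite mulVf ?mulr1// pnatr_eq0 -lt0n.
  have iG : i \in finset.cover G by case/and3P: PG => /eqP -> _ _; rewrite inE.
  rewrite (bigD1 (finset.pblock G i)) ?finset.pblock_mem//= finset.mem_pblock iG big1 ?addr0//.
  move=> S /andP[SG Si]; case: (boolP (i \in S)) => // iS.
  case/and3P: PG => _ tG _; move: Si.
  by rewrite (finset.def_pblock tG SG iS) eqxx.
- rewrite /mxtrace; under eq_bigr do rewrite ZE.
  rewrite exchange_big/= -sum1_card natr_sum; apply: eq_bigr => S /G0 S0.
  rewrite -mulr_sumr (eq_bigr (fun j => (j \in S)%:R)) ?sumS.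
    by rewrite mulVf// pnatr_eq0 -lt0n.
  by move=> j _; case: (j \in S); rewrite ?mulr1 ?mulr0.
- move=> i j; rewrite ZE; apply: sumr_ge0 => S _.
  by rewrite !mulr_ge0 ?invr_ge0.
- split.
    by apply/matrixP => i j; rewrite mxE !ZE; apply: eq_bigr => S _; rewrite [X in _ * X]mulrC.
  (* The quadratic form at [v] is tr (Z v v^T), which the trace formula with A = v turns into a
     nonnegative sum. *)
  move=> v; have := cluster_mx_trace G v.
  rewrite mulmxA mxtrace_mulC mulmxA [\tr _]big_ord1 => ->.
  by apply: sumr_ge0 => S _; rewrite mulr_ge0 ?invr_ge0 ?sqnorm_ge0.
Qed.

Lemma cluster_mx_value (m d : nat) (Y : 'I_m -> 'rV[R]_d) (G : {set {set 'I_m}}) :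
  finset.partition G [set: 'I_m] ->
  ((2 * m)%:R)^-1 * \tr (distmx Y *m cluster_mx G) = kmeans_cost Y G.
Proof.
move=> PG; rewrite (sdp_valueE Y (cluster_mx_feasible PG)); congr (_ * _).
rewrite cluster_mx_trace mxtrace_mul_tr_row.
have -> : \sum_i sqnorm (row i (points_mx Y)) =
    \sum_(S in G) \sum_(i in S) sqnorm (Y i).
  rewrite -(set_partition_big _ PG); apply: eq_big => i; first by rewrite inE.
  by rewrite rowK.
rewrite -sumrB; apply: eq_bigr => S SG.
have S0 : (0 < #|S|)%N.
  by rewrite card_gt0; apply: contraTneq SG => ->; case/and3P: PG.
rewrite (sum_sqdist _ _ S0) subrr.
have -> : sqnorm (0 : 'rV[R]_d) = 0.
  by rewrite /sqnorm big1// => p _; rewrite mxE expr0n.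
rewrite mulr0 addr0 /centroid sqnormZ; congr (_ - _).
under eq_bigr do rewrite rowK.
by field; rewrite pnatr_eq0 -lt0n.
Qed.

Lemma SDP_ge (m d k : nat) (Y : 'I_m -> 'rV[R]_d) (x : R) :
  (0 < k)%N -> (k <= m)%N ->
  (forall Z, SDP_feasible k Z -> x <= ((2 * m)%:R)^-1 * \tr (distmx Y *m Z)) ->
  x <= SDP Y k.
Proof.
move=> k0 km xZ; apply: lb_le_inf; last by move=> _ [Z [fZ ->]]; exact: xZ.
(* A lower bound passes to the infimum only over a nonempty set; the constant labelling, refined to
   [k] blocks, provides a feasible matrix. *)
have [G [PG Gk _]] := partition_of_labelling Y (fun=> Ordinal k0) (fun=> 0) km.
exists (kmeans_cost Y G), (cluster_mx G); rewrite cluster_mx_value//.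
by split=> //; rewrite -Gk; exact: cluster_mx_feasible.
Qed.

Lemma SDP_ge0 (m d k : nat) (Y : 'I_m -> 'rV[R]_d) :
  (0 < k)%N -> (k <= m)%N -> 0 <= SDP Y k.
Proof.
by move=> k0 km; apply: SDP_ge => // Z fZ; exact: SDP_feasible_value_ge0 fZ.
Qed.

Lemma SDP_le_labelling (m d k : nat) (Y : 'I_m -> 'rV[R]_d)
    (f : 'I_m -> 'I_k) (c : 'I_k -> 'rV[R]_d) : (k <= m)%N ->
  SDP Y k <= m%:R^-1 * \sum_j sqnorm (Y j - c (f j)).
Proof.
move=> km; have [G [PG Gk le_cost]] := partition_of_labelling Y f c km.
apply: le_trans le_cost; rewrite -(cluster_mx_value _ PG); apply: ge_inf.
  by exists 0 => _ [Z [fZ ->]]; exact: SDP_feasible_value_ge0 fZ.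
by exists (cluster_mx G); split=> //; rewrite -Gk; exact: cluster_mx_feasible.
Qed.

(* Discarding the row space of [U] costs nothing since [Z <= 1], and there the
   centres disappear; the rest of [Z] has trace [k]. *)
Lemma SDP_ge_noise (s d k m : nat) (Y : 'I_s -> 'rV[R]_d)
    (M N : 'M[R]_(s, d)) (U : 'M[R]_(m, d)) (K : R) :
  (0 < k)%N -> (k <= s)%N -> points_mx Y = M + N ->
  U *m U^T = 1%:M -> M *m U^T *m U = M ->
  (forall v : 'rV[R]_s, sqnorm (v *m N) <= K * sqnorm v) ->
  s%:R^-1 * (\tr (N *m N^T) - \tr ((N *m U^T) *m (N *m U^T)^T) - K * k%:R)
  <= SDP Y k.
Proof.
move=> k0 ks YE UU MU NK; apply: SDP_ge => // Z fZ.
rewrite (sdp_valueE Y fZ) ler_wpM2l ?invr_ge0//.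
set A := points_mx Y in YE *.
have trU (B : 'M[R]_(s, d)) : (B *m U^T) *m (B *m U^T)^T = B *m (U^T *m U) *m B^T.
  by rewrite trmx_mul trmxK !mulmxA.
(* [Q] projects orthogonally to the row space of [U]; it kills the centres [M], so A Q = N Q. *)
pose Q := 1%:M - U^T *m U.
have QT : Q^T = Q by rewrite linearB/= trmx1 trmx_mul trmxK.
have QQ : Q *m Q = Q.
  rewrite {1}/Q mulmxBl mul1mx {2}/Q mulmxBr mulmx1 mulmxA -(mulmxA U^T) UU.
  by rewrite mulmx1 subrr subr0.
have AQ : A *m Q = N *m Q.
  by rewrite YE mulmxDl [M *m Q]mulmxBr mulmx1 mulmxA MU subrr add0r.
have split (B : 'M[R]_(s, d)) : B *m B^T =
    (B *m Q) *m (B *m Q)^T + (B *m U^T) *m (B *m U^T)^T.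
  rewrite trU trmx_mul QT -!mulmxA (mulmxA Q) QQ -mulmxDr.
  by rewrite (mulmxA U^T) -mulmxDl /Q subrK mul1mx.
rewrite (split A) (split N) AQ [Z *m (_ + _)]mulmxDr !mxtraceD.
have h1 := SDP_feasible_le1 (A *m U^T) fZ.
have h2 : \tr (Z *m (N *m Q *m (N *m Q)^T)) <= K * k%:R.
  have [_ trZ _ Zpsd] := fZ; rewrite -trZ.
  (* The projection [Q] may be dropped: it only omits the nonnegative trace of Z against the part of
     N N^T in the row space of [U]. *)
  apply: le_trans (psd_mxtrace_le Zpsd NK).
  by rewrite (split N) mulmxDr mxtraceD lerDl psd_mxtrace_ge0.
move: h1 h2; set a1 := \tr _; set a2 := \tr _; set a3 := \tr _; set a4 := \tr _.
set a5 := \tr _; lra.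
Qed.

End kmeans.

(** * Sampling without replacement *)

Section sampling.
Context {R : realType}.

Local Notation inj_pred s n := [pred v : {ffun 'I_s -> 'I_n} | injectiveb v].

Lemma card_mkset (T : finType) (p : pred T) : #|[set x | p x]| = #|p|.
Proof. by apply: eq_card => x; apply/idP/idP => [/set_mem|/mem_set]. Qed.

Lemma card_valid_sample (n s l : nat) :
  #|[set w : samples n s l | valid_sample w]| = (#|inj_pred s n| ^ l)%N.
Proof.
rewrite card_mkset -[in RHS](card_ord l) -card_ffun_on; apply: eq_card => w.
by apply/forallP/ffun_onP => h i; exact: h.
Qed.

Lemma card_inj_gt0 (n s : nat) : (s <= n)%N -> (0 < #|inj_pred s n|)%N.
Proof.
move=> sn; apply/card_gt0P; exists [ffun i => widen_ord sn i].
by apply/injectiveP => i j; rewrite !ffunE => /(congr1 val)/= /val_inj.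
Qed.

(** Each coordinate of a uniform injection is uniform: composing with a transposition permutes the
    injections, so the number [N i] of those with v j = i does not depend on i. *)
Lemma sum_inj_eval (n s : nat) (phi : 'I_n -> R) (j : 'I_s) :
  n%:R * \sum_(v : {ffun 'I_s -> 'I_n} | injectiveb v) phi (v j)
  = #|inj_pred s n|%:R * \sum_i phi i.
Proof.
pose N i : R := \sum_(v : {ffun 'I_s -> 'I_n} | injectiveb v) (v j == i)%:R.
have NE i i' : N i = N i'.
  pose h (v : {ffun 'I_s -> 'I_n}) := [ffun x => tperm i i' (v x)].
  have hK : involutive h by move=> v; apply/ffunP => x; rewrite !ffunE tpermK.
  rewrite /N (reindex_inj (inv_inj hK)); apply: eq_big => v.
    apply/injectiveP/injectiveP => vi x y.
      by move=> e; apply: vi; rewrite !ffunE e.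
    by rewrite !ffunE => /perm_inj; exact: vi.
  by move=> _; rewrite ffunE (canF_eq (tpermK i i')) tpermL.
have phiE : \sum_(v : {ffun 'I_s -> 'I_n} | injectiveb v) phi (v j) =
    \sum_i phi i * N i.
  rewrite (partition_big (fun v : {ffun 'I_s -> 'I_n} => v j) predT)//=.
  apply: eq_bigr => i _; rewrite /N mulr_sumr big_mkcondr/=.
  apply: eq_bigr => v _; case: eqP => [->|_]; first by rewrite mulr1.
  by rewrite mulr0.
rewrite phiE mulr_sumr mulr_sumr; apply: eq_bigr => i _.
rewrite mulrCA mulrC; congr (_ * _).
transitivity (\sum_(i' < n) N i').
  by under eq_bigr do rewrite (NE _ i); rewrite sumr_const card_ord mulr_natl.
rewrite exchange_big/= -sum1_card natr_sum; apply: eq_bigr => v _.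
rewrite (bigD1 (v j))//= eqxx big1 ?addr0// => i' /negbTE.
by rewrite eq_sym => ->.
Qed.

(** For any partition of X, the sample inherits the labels and keeps the centroids of X as centres.
    Its cost is then the average of [phi] over the sample, whose mean is the cost of the
    partition. *)
Lemma mean_SDP_le_IP (n d k s : nat) (X : 'I_n -> 'rV[R]_d) :
  (0 < k)%N -> (k <= s)%N -> (s <= n)%N ->
  \sum_(v : {ffun 'I_s -> 'I_n} | injectiveb v) SDP (X \o v) k
  <= #|inj_pred s n|%:R * IP X k.
Proof.
move=> k0 ks sn.
have J0 : 0 < #|inj_pred s n|%:R :> R by rewrite ltr0n card_inj_gt0.
have s0 : (0 < s)%N by exact: leq_trans ks.
have n0 : (0 < n)%N by exact: leq_trans sn.
rewrite -ler_pdivrMl//; apply: lb_le_inf.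
  have [G [PG Gk _]] := partition_of_labelling X (fun=> Ordinal k0) (fun=> 0)
    (leq_trans ks sn).
  by exists (kmeans_cost X G), G; rewrite PG Gk eqxx.
move=> _ [G [/andP[PG /eqP Gk] ->]]; rewrite ler_pdivrMl//.
have bG i : finset.pblock G i \in G.
  by apply: finset.pblock_mem; case/and3P: PG => /eqP -> _ _; rewrite inE.
pose f i := enum_rank_in (bG i) (finset.pblock G i).
have fE i : enum_val (f i) = finset.pblock G i by rewrite enum_rankK_in.
pose c (r : 'I_#|G|) := centroid X (enum_val r).
pose phi i := sqnorm (X i - c (f i)).
have costE : kmeans_cost X G = n%:R^-1 * \sum_i phi i.
  congr (_ * _); have -> : \sum_i phi i = \sum_(i in [set: 'I_n]%SET) phi i.
    by apply: eq_bigl => i; rewrite inE.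
  rewrite (set_partition_big _ PG); apply: eq_bigr => S SG; apply: eq_bigr => i iS.
  rewrite /phi /c fE; case/and3P: PG => _ tG _.
  by rewrite (finset.def_pblock tG SG iS).
rewrite -Gk in ks *.
apply: (@le_trans _ _ (\sum_(v : {ffun 'I_s -> 'I_n} | injectiveb v)
    s%:R^-1 * \sum_j phi (v j))).
  by apply: ler_sum => v _; exact: (SDP_le_labelling (X \o v) (f \o v) c ks).
rewrite -mulr_sumr exchange_big/= costE.
have evE (j : 'I_s) : \sum_(v : {ffun 'I_s -> 'I_n} | injectiveb v) phi (v j)
    = n%:R^-1 * (#|inj_pred s n|%:R * \sum_i phi i).
  by rewrite -(sum_inj_eval _ j) mulKf// pnatr_eq0 -lt0n.
under eq_bigr do rewrite evE.
rewrite sumr_const card_ord -[X in _ * X]mulr_natl mulKf ?pnatr_eq0 -?lt0n//.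
by rewrite mulrCA.
Qed.

Lemma markov_count (T : finType) (p : pred T) (f : T -> R) (e a : R) :
  0 <= e -> (forall x, p x -> 0 <= f x) ->
  \sum_(x | p x) f x <= #|p|%:R * a ->
  #|[pred x | p x & a < e * f x]|%:R <= e * #|p|%:R.
Proof.
move=> e0 f0 fa; set B := [pred x | p x & a < e * f x].
have [B0|B0] := posnP #|B|; first by rewrite B0 mulr_ge0.
have [x0 /andP[px0 ax0]] := card_gt0P B0.
have p0 : 0 < #|p|%:R :> R by rewrite ltr0n; apply/card_gt0P; exists x0.
have a0 : 0 <= a.
  rewrite -(pmulr_rge0 _ p0) (le_trans _ fa)//; exact: sumr_ge0.
have BpE : \sum_(x | B x) a = #|B|%:R * a.
  by rewrite sumr_const mulr_natl.
have BE : \sum_(x | B x) e * f x <= e * (#|p|%:R * a).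
  apply: le_trans (ler_wpM2l e0 fa); rewrite mulr_sumr big_mkcondr/=.
  by apply: ler_sum => x px; case: ifP => // _; rewrite mulr_ge0 ?f0.
(* The strict inequality is what rules out a = 0, where it would read 0 < 0. *)
have lt_sum : #|B|%:R * a < \sum_(x | B x) e * f x.
  rewrite -BpE; apply: ltr_sum; last by move=> x /andP[].
  by apply/hasP; exists x0; rewrite ?mem_index_enum//; apply/andP.
have : #|B|%:R * a < e * #|p|%:R * a by rewrite -mulrA; exact: lt_le_trans BE.
have [->|ane0] := eqVneq a 0; first by rewrite !mulr0 ltxx.
have apos : 0 < a by rewrite lt_def ane0.
by rewrite ltr_pM2r// => /ltW.
Qed.

Lemma BM_le (n d s l : nat) (X : 'I_n -> 'rV[R]_d) (k : nat) (eps : R)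
    (w : samples n s l) (i : 'I_l) : (0 < k)%N -> (k <= s)%N ->
  BM X k eps w <= eps `^ l%:R^-1 * SDP (subsample X w i) k.
Proof.
move=> k0 ks; rewrite ler_wpM2l ?powR_ge0//; apply: ge_inf; last by exists i.
by exists 0 => _ [j _ <-]; exact: SDP_ge0.
Qed.

Lemma BM_ge (n d s l : nat) (X : 'I_n -> 'rV[R]_d) (k : nat) (eps x : R)
    (w : samples n s l) : (0 < l)%N ->
  (forall i, x <= SDP (subsample X w i) k) ->
  eps `^ l%:R^-1 * x <= BM X k eps w.
Proof.
move=> l0 xS; rewrite ler_wpM2l ?powR_ge0//; apply: lb_le_inf.
  by exists (SDP (subsample X w (Ordinal l0)) k), (Ordinal l0).
by move=> _ [j _ <-].
Qed.

Lemma markov_bound (n d : nat) (X : 'I_n -> 'rV[R]_d) (k s l : nat) (eps : R) :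
  (0 < k)%N -> (k <= s)%N -> (s <= n)%N -> (0 < l)%N -> 0 < eps ->
  1 - eps <= proc_prob (fun w : samples n s l => BM X k eps w <= IP X k).
Proof.
move=> k0 ks sn l0 eps0; rewrite /proc_prob card_valid_sample card_mkset.
set E := (fun w => _ : bool); set J := inj_pred s n.
have J0 : 0 < #|J|%:R :> R by rewrite ltr0n card_inj_gt0.
pose e := eps `^ l%:R^-1.
have e0 : 0 <= e by exact: powR_ge0.
have el : e ^+ l = eps.
  rewrite -powR_mulrn// -powRrM mulVf ?pnatr_eq0 -?lt0n//.
  by rewrite powRr1// ltW.
pose B := [pred v : {ffun 'I_s -> 'I_n} | injectiveb v & IP X k < e * SDP (X \o v) k].
have BJ : #|B|%:R <= e * #|J|%:R.
  by apply: markov_count => //; [move=> v _; exact: SDP_ge0|exact: mean_SDP_le_IP].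
(* A valid outcome violating the bound has all its components in [B], so there are at most #|B|^l of
   them: independence of the draws becomes a power, which cancels the exponent 1/l. *)
have cE : (#|[pred w : samples n s l | valid_sample w]| <= #|E| + #|B| ^ l)%N.
  have <- : #|ffun_on_mem 'I_l (mem B)| = (#|B| ^ l)%N by rewrite card_ffun_on card_ord.
  rewrite -cardUI.
  apply: leq_trans (leq_addr _ _); apply: subset_leq_card.
  apply/fintype.subsetP => w; rewrite !inE => vw.
  have [Ew|/= nE] := boolP (E w); first by apply/orP; left.
  rewrite /E vw /= in nE; apply/orP; right; apply/ffun_onP => i; rewrite !inE.
  rewrite (forallP vw i) /= ltNge; apply: contra nE => h.
  exact: le_trans (BM_le X eps w i k0 ks) h.
have vE : #|[pred w : samples n s l | valid_sample w]| = (#|J| ^ l)%N.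
  by rewrite -card_valid_sample card_mkset; apply: eq_card.
rewrite ler_pdivlMr; last by rewrite natrX exprn_gt0.
move: cE; rewrite vE -(ler_nat R) natrD !natrX => cE.
have : #|B|%:R ^+ l <= eps * #|J|%:R ^+ l.
  by rewrite -el -exprMn ler_pXn2r// nnegrE ?mulr_ge0// ltW.
by rewrite mulrBl mul1r lerBlDr => h; apply: le_trans cE _; rewrite lerD2l.
Qed.

End sampling.

(** * A net of the unit ball and Gaussian matrices *)

Section net.
Context {R : realType}.
Variables d D : nat.
Hypotheses (d0 : (0 < d)%N) (D1 : (1 < D)%N).

(** An error of at most one such step in each of [d] coordinates has norm at most 1/D. *)
Definition net_step : R := (D%:R * Num.sqrt d%:R)^-1.

(** Coordinates are coded by sign and magnitude. Zero has two codes, which is harmless for an upper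
    bound on the size of the net. *)
Definition net_pt (z : {ffun 'I_d -> bool * 'I_(D * d).+1}) : 'rV[R]_d :=
  \row_j ((-1) ^+ (z j).1 * (z j).2%:R * net_step).

(** Since |u|_1 <= sqrt d on the unit ball, the magnitudes of a point rounded towards zero sum to at
    most D d; this keeps the count exponential in [d]. *)
Definition net : pred {ffun 'I_d -> bool * 'I_(D * d).+1} :=
  fun z => (sqnorm (net_pt z) <= 1) && (\sum_j (z j).2 <= D * d)%N.

Let D0 : 0 < D%:R :> R. Proof. by rewrite ltr0n ltnW. Qed.
Let sd0 : 0 < Num.sqrt d%:R :> R. Proof. by rewrite sqrtr_gt0 ltr0n. Qed.
Let sd2 : Num.sqrt d%:R * Num.sqrt d%:R = d%:R :> R.
Proof. by rewrite -expr2 sqr_sqrtr. Qed.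
Let h0 : 0 < net_step. Proof. by rewrite invr_gt0 mulr_gt0. Qed.

(* Coordinates are rounded towards zero, so that the net stays in the ball. *)
Lemma net_approx (u : 'rV[R]_d) : sqnorm u <= 1 ->
  exists2 z, net z & sqnorm (u - net_pt z) <= (D%:R^-1) ^+ 2.
Proof.
move=> u1; pose t j := Num.truncn (`|u ord0 j| / net_step).
have tlo j : (t j)%:R <= `|u ord0 j| / net_step.
  by rewrite truncn_le divr_ge0// ltW.
have thi j : `|u ord0 j| / net_step < (t j)%:R + 1.
  by rewrite natr1; exact: truncnS_gt.
have sumu : \sum_j `|u ord0 j| <= Num.sqrt d%:R.
  apply: (@le_trans _ _ (\sum_j ((Num.sqrt d%:R * u ord0 j ^+ 2 +
      (Num.sqrt d%:R)^-1) / 2))).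
    apply: ler_sum => j _; rewrite -[u ord0 j ^+ 2]real_normK ?num_real//.
    set x := `|_|; set y := Num.sqrt _.
    rewrite -subr_ge0 (_ : _ - _ = (y * x - 1) ^+ 2 / (2 * y)).
      by rewrite divr_ge0 ?sqr_ge0// mulr_ge0 ?ltW.
    by field; rewrite gt_eqF.
  rewrite -mulr_suml big_split/= -mulr_sumr sumr_const card_ord.
  have -> : (Num.sqrt d%:R)^-1 *+ d = Num.sqrt d%:R :> R.
    by apply: (mulfI (lt0r_neq0 sd0)); rewrite mulrnAr mulfV ?lt0r_neq0// sd2.
  rewrite ler_pdivrMr// mulr_natr mulr2n lerD2r.
  by rewrite ler_piMr// ltW.
have sumt : (\sum_j t j <= D * d)%N.
  rewrite -(ler_nat R) natr_sum.
  apply: (@le_trans _ _ (\sum_j `|u ord0 j| / net_step)); first exact: ler_sum.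
  have K0 : 0 <= D%:R * Num.sqrt d%:R :> R by rewrite mulr_ge0 ?sqrtr_ge0.
  rewrite -mulr_suml invrK (le_trans (ler_wpM2r K0 sumu))//.
  by rewrite mulrCA sd2 natrM.
have tb j : (t j < (D * d).+1)%N.
  by rewrite ltnS (leq_trans _ sumt)// (bigD1 j)//= leq_addr.
pose z := [ffun j => (u ord0 j < 0, Ordinal (tb j))].
have zE j : net_pt z ord0 j = (-1) ^+ (u ord0 j < 0)%R * ((t j)%:R * net_step).
  by rewrite mxE ffunE /= mulrA.
have uE j : u ord0 j = (-1) ^+ (u ord0 j < 0)%R * `|u ord0 j| by rewrite -numEsign.
have th0 j : 0 <= (t j)%:R * net_step by rewrite mulr_ge0// ltW.
have tle j : (t j)%:R * net_step <= `|u ord0 j| by rewrite -ler_pdivlMr.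
exists z.
  apply/andP; split.
    apply: le_trans u1; apply: ler_sum => j _.
    rewrite zE [in leRHS]uE !exprMn sqrr_sign !mul1r -exprMn.
    by rewrite ler_sqr ?nnegrE.
  by under eq_bigr do rewrite ffunE.
have -> : (D%:R^-1) ^+ 2 = \sum_(j < d) net_step ^+ 2.
  rewrite sumr_const card_ord -[_ *+ d]mulr_natl /net_step invfM exprMn.
  move: sd2 sd0; set y := Num.sqrt _ => <- y0.
  by field; rewrite !gt_eqF.
apply: ler_sum => j _.
have -> : (u - net_pt z) ord0 j =
    (-1) ^+ (u ord0 j < 0)%R * (`|u ord0 j| - (t j)%:R * net_step).
  by rewrite !mxE -mulrA mulrBr -uE ffunE/=; congr (_ - _); rewrite mulrA.
rewrite exprMn sqrr_sign mul1r ler_sqr ?nnegrE ?subr_ge0 ?(ltW h0)//.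
apply: ltW; rewrite ltrBlDr -{1}[net_step]mul1r -mulrDl -ltr_pdivrMr// [1 + _]addrC.
exact: thi.
Qed.

(* Rankin's trick: weight the grid point [z] by [r ^+ |z|_1], r = D / (D + 1). *)
Lemma card_net_le :
  #|net|%:R <= expR d%:R * (2 * D.+1%:R) ^+ d :> R.
Proof.
pose r : R := D%:R / D.+1%:R.
have S0 : 0 < D.+1%:R :> R by [].
have r0 : 0 < r by rewrite divr_gt0.
have r1 : 1 - r = D.+1%:R^-1 by rewrite /r -natr1; field; rewrite natr1 pnatr_eq0.
(* Here r^-D = (1 + 1/D)^D <= e. The other factor comes from a geometric series in each coordinate,
   of sum at most 1 / (1 - r) = D + 1, doubled by the sign. *)
have rinv : (r ^+ (D * d))^-1 <= expR d%:R.
  rewrite -exprVn exprM.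
  have -> : expR d%:R = (expR D%:R^-1 ^+ D) ^+ d :> R.
    by rewrite -!expRM_natl mulfV ?mulr1 ?gt_eqF.
  have rV : r^-1 = 1 + D%:R^-1 by rewrite /r -natr1; field; rewrite natr1 !pnatr_eq0 -lt0n ltnW.
  have rV0 : 0 <= r^-1 by rewrite invr_ge0 ltW.
  do 2 (apply: lerXn2r; rewrite ?nnegrE ?exprn_ge0 ?expR_ge0//).
  by rewrite rV expR_ge1Dx.
have geo n : \sum_(i < n) r ^+ i <= D.+1%:R.
  rewrite -[leRHS]invrK -r1.
  have r1' : 0 < 1 - r by rewrite r1 invr_gt0.
  rewrite -[leRHS]mul1r ler_pdivlMr// mulrC.
  by rewrite -opprB mulNr -subrX1 opprB lerBlDr lerDl exprn_ge0// ltW.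
have -> : #|net|%:R = \sum_(z | net z) 1 :> R by rewrite sumr_const.
apply: (@le_trans _ _ (\sum_(z : {ffun 'I_d -> bool * 'I_(D * d).+1})
    (r ^+ (D * d))^-1 * \prod_j r ^+ (z j).2)).
  rewrite big_mkcond/=; apply: ler_sum => z _; rewrite prodrXr; case: ifP => [|_].
    move=> /andP[_ hz]; rewrite ler_pdivlMl ?exprn_gt0// mulr1.
    by rewrite ler_wiXn2l// ltW// -subr_gt0 r1 invr_gt0.
  by rewrite mulr_ge0 ?invr_ge0 ?exprn_ge0// ltW.
rewrite -mulr_sumr ler_pM ?invr_ge0 ?exprn_ge0//; first exact: ltW.
  by apply: sumr_ge0 => z _; apply: prodr_ge0 => j _; rewrite exprn_ge0 ?ltW.
rewrite -(bigA_distr_bigA (fun (_ : 'I_d) (p : bool * 'I_(D * d).+1) => r ^+ p.2)).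
rewrite prodr_const card_ord; apply: lerXn2r; rewrite ?nnegrE//.
  by apply: sumr_ge0 => p _; rewrite exprn_ge0 ?ltW.
rewrite -(pair_bigA _ (fun (b : bool) (i : 'I_(D * d).+1) => r ^+ i))/=.
by rewrite sumr_const card_bool -[leLHS]mulr_natl; apply: ler_wpM2l => //; exact: geo.
Qed.

(** Let S be the supremum of |u A|^2 over the unit ball and dl = 1/D. Rounding u and using |x + y|^2
    <= |x|^2 / (1 - dl) + |y|^2 / dl gives S <= a / (1 - dl) + dl S, hence the factor (1 -
    dl)^-2. *)
Lemma net_opnorm (s : nat) (A : 'M[R]_(d, s)) (a : R) :
  (forall z, net z -> sqnorm (net_pt z *m A) <= a) ->
  forall u, sqnorm (u *m A) <= a / (1 - D%:R^-1) ^+ 2 * sqnorm u.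
Proof.
move=> Aa; set dl : R := D%:R^-1.
have dl0 : 0 < dl by rewrite invr_gt0.
have dl1 : 0 < 1 - dl by rewrite subr_gt0 invf_lt1// ltr1n.
pose B := [set sqnorm (u *m A) | u in [set u : 'rV[R]_d | sqnorm u <= 1]].
have B0 : B !=set0.
  exists (sqnorm ((0 : 'rV[R]_d) *m A)), 0 => //=.
  by rewrite /sqnorm big1// => j _; rewrite mxE expr0n.
(* Absorbing dl S into the left side requires S to be finite; a crude bound is enough. *)
have Bub : has_ubound B.
  exists (\sum_i (\sum_j `|A j i|) ^+ 2) => _ [u /= u1 <-].
  apply: ler_sum => i _; rewrite -[leLHS]real_normK ?num_real// mxE.
  rewrite ler_sqr ?nnegrE ?sumr_ge0// (le_trans (ler_norm_sum _ _ _))//.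
  apply: ler_sum => j _; rewrite normrM ler_piMl//.
  rewrite -(@ler_sqr _ _ 1) ?nnegrE// real_normK ?num_real// expr1n.
  apply: le_trans u1; rewrite /sqnorm (bigD1 j)//= lerDl.
  by apply: sumr_ge0 => p _; exact: sqr_ge0.
pose S := sup B.
have SB u : sqnorm u <= 1 -> sqnorm (u *m A) <= S.
  by move=> u1; apply: ub_le_sup => //; exists u.
have SZ u : sqnorm u <= dl ^+ 2 -> sqnorm (u *m A) <= dl ^+ 2 * S.
  move=> ud; have := SB (dl^-1 *: u).
  rewrite -scalemxAl !sqnormZ exprVn => /(_ _).
  rewrite ler_pdivrMl ?exprn_gt0// mulr1 => /(_ ud).
  by rewrite ler_pdivrMl ?exprn_gt0.
have S0 : 0 <= S.
  have [_ [u u1 _]] := B0; exact: le_trans (sqnorm_ge0 _) (SB _ u1).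
have Sle : S <= a / (1 - dl) + dl * S.
  apply: ge_sup; [exact: B0|move=> _ [u /= u1 <-]].
  have [z nz uz] := net_approx u1.
  have -> : u *m A = net_pt z *m A + (u - net_pt z) *m A.
    by rewrite mulmxBl addrC subrK.
  set x := net_pt z *m A; set y := (u - net_pt z) *m A.
  have : sqnorm (x + y) <= sqnorm x / (1 - dl) + sqnorm y / dl.
    rewrite /sqnorm !mulr_suml -big_split/=; apply: ler_sum => j _.
    rewrite mxE; set p := x _ _; set q := y _ _.
    rewrite -subr_ge0 (_ : _ - _ = (dl * p - (1 - dl) * q) ^+ 2 / (dl * (1 - dl))).
      by rewrite divr_ge0 ?sqr_ge0 ?mulr_ge0 ?ltW.
    by field; rewrite !gt_eqF.
  move=> /le_trans; apply; apply: lerD.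
    by rewrite ler_pM2r ?invr_gt0// Aa.
  rewrite ler_pdivrMr// mulrAC -expr2; exact: SZ.
have SK : S <= a / (1 - dl) ^+ 2.
  by rewrite expr2 invfM mulrA ler_pdivlMr// mulrBr mulr1 lerBlDr (mulrC S).
move=> u; have [u0|un0] := eqVneq (sqnorm u) 0.
  rewrite u0 mulr0 (sqnorm0_eq u0) mul0mx /sqnorm big1// => j _.
  by rewrite mxE expr0n.
have un : 0 < sqnorm u by rewrite lt_def un0 sqnorm_ge0.
have := SB ((Num.sqrt (sqnorm u))^-1 *: u).
rewrite -scalemxAl !sqnormZ exprVn sqr_sqrtr ?sqnorm_ge0// mulVf// lexx => /(_ isT).
by rewrite ler_pdivrMl// mulrC => /le_trans; apply; rewrite ler_pM2r.
Qed.

End net.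

Section gaussian_rows.
Context {R : realType} {dT : measure_display} {Omega : measurableType dT}.
Variables (P : probability Omega R) (s d : nat) (C : set Omega).
Variable Z : 'I_s * 'I_d -> Omega -> R.
Hypothesis mZ : forall i, measurable_fun setT (Z i).
Hypothesis mC : measurable C.
Hypothesis Z_indep : forall A : 'I_s * 'I_d -> set R,
  (forall i, measurable (A i)) ->
  P (C `&` \bigcap_i (Z i @^-1` A i))
  = (fine (P C) * \prod_i fine (normal_prob 0 1 (A i)))%:E.

Definition noise_mx (om : Omega) : 'M[R]_(s, d) := \matrix_(i, j) Z (i, j) om.

Lemma noise_mx_sum (om : Omega) :
  \tr (noise_mx om *m (noise_mx om)^T) = \sum_p Z p om ^+ 2.
Proof.
rewrite mxtrace_mul_tr pair_big/=; apply: eq_bigr => -[i j] _.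
by rewrite mxE.
Qed.

(** The rows of the Kronecker product of the identity with [U]: orthonormal rows of [U] give an
    orthonormal family in dimension s d, as the vector estimates require. *)
Let coef (m : nat) (U : 'M[R]_(m, d)) (q : 'I_s * 'I_m) (p : 'I_s * 'I_d) : R :=
  (q.1 == p.1)%:R * U q.2 p.2.

Let coefE (m : nat) (U : 'M[R]_(m, d)) (q : 'I_s * 'I_m) (f : 'I_s * 'I_d -> R) :
  \sum_p coef U q p * f p = \sum_j U q.2 j * f (q.1, j).
Proof.
transitivity (\sum_i \sum_j coef U q (i, j) * f (i, j)).
  by rewrite pair_big/=; apply: eq_bigr => -[].
rewrite (bigD1 q.1)//= [X in _ + X]big1 ?addr0.
  by apply: eq_bigr => j _; rewrite /coef eqxx mul1r.
move=> i; rewrite eq_sym => /negbTE qi; rewrite big1// => j _.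
by rewrite /coef/= qi !mul0r.
Qed.

Let noise_mx_mul (m : nat) (U : 'M[R]_(m, d)) (om : Omega) :
  \tr (noise_mx om *m U^T *m (noise_mx om *m U^T)^T)
  = \sum_q (\sum_p coef U q p * Z p om) ^+ 2.
Proof.
rewrite mxtrace_mul_tr pair_big/=; apply: eq_bigr => -[i q] _.
rewrite coefE/= mxE; congr (_ ^+ 2); apply: eq_bigr => j _.
by rewrite !mxE mulrC.
Qed.

Lemma measurable_noise (m : nat) (U : 'M[R]_(m, d)) (a lam c : R) :
  measurable [set om | c <= a * \tr (noise_mx om *m (noise_mx om)^T)
    + lam * \tr (noise_mx om *m U^T *m (noise_mx om *m U^T)^T)].
Proof.
pose F x := a * (\sum_p Z p x ^+ 2)
      + lam * \sum_q (\sum_p coef U q p * Z p x) ^+ 2.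
have mF : measurable_fun setT F.
  apply: measurable_funD; apply: measurable_funM => //; apply: measurable_sum => q.
    exact: measurable_funX.
  apply: measurable_funX; apply: measurable_sum => p; exact: measurable_funM.
rewrite (_ : mkset _ = F @^-1` `[c, +oo[%classic).
  by rewrite -[X in measurable X]setTI; exact: mF.
apply/seteqP; split => x /=; rewrite in_itv/= andbT /F.
  by rewrite noise_mx_sum noise_mx_mul.
by rewrite noise_mx_sum noise_mx_mul.
Qed.

Lemma noise_chernoff (m : nat) (U : 'M[R]_(m, d)) (a lam c : R) :
  U *m U^T = 1%:M -> a < 2^-1 -> 0 <= lam -> 2 * lam < 1 - 2 * a ->
  fine (P (C `&` [set om | c <= a * \tr (noise_mx om *m (noise_mx om)^T)
    + lam * \tr (noise_mx om *m U^T *m (noise_mx om *m U^T)^T)]))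
  <= fine (P C) * (expR (- c) * (Num.sqrt (1 - 2 * a)^-1 ^+ (s * d)
        * Num.sqrt (1 - 2 * (1 - 2 * a)^-1 * lam)^-1 ^+ (s * m))).
Proof.
move=> UU a2 lam0 lam2.
have ortho p q : \sum_i coef U p i * coef U q i = (p == q)%:R.
  rewrite coefE /coef/=; case: p q => [p1 p2] [q1 q2] /=.
  under eq_bigr do rewrite mulrCA.
  rewrite -mulr_sumr xpair_eqE (eq_sym q1).
  have -> : \sum_j U p2 j * U q2 j = (p2 == q2)%:R.
    have := congr1 (fun A : 'M[R]_m => A p2 q2) UU; rewrite !mxE => <-.
    by apply: eq_bigr => j _; rewrite mxE.
  by rewrite -natrM mulnb.
have := gaussian_chernoff mZ mC Z_indep ortho c a2 lam0 lam2.
rewrite !card_prod !card_ord; apply: le_trans.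
rewrite le_eqVlt; apply/orP; left; apply/eqP.
congr (fine (P (_ `&` _))); apply/seteqP; split => x /=;
  by rewrite noise_mx_sum noise_mx_mul.
Qed.

End gaussian_rows.

(** * Numerical bounds *)

Section numeric_bounds.
Context {R : realType}.

Lemma expR_ge_taylor (x : R) (n : nat) : 0 <= x ->
  \sum_(0 <= i < n) x ^+ i / i`!%:R <= expR x.
Proof.
move=> x0; have := @nondecreasing_cvgn_le R (series (exp_coeff x)).
apply; last exact: is_cvg_series_exp_coeff.
apply/nondecreasing_seqP => m; rewrite /series/= big_nat_recr//= lerDl.
by rewrite /exp_coeff/= divr_ge0 ?exprn_ge0.
Qed.

(* 139/200 exceeds ln 2 by less than 0.3 percent, hence the fourth-order Taylor
   polynomial. *)
Lemma two_le_expR : 2 <= expR (139 / 200) :> R.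
Proof.
have x0 : 0 <= 139 / 200 :> R by lra.
apply: le_trans (expR_ge_taylor 5 x0).
rewrite unlock /= /index_iota /=.
by rewrite (_ : 0`! = 1)%N// (_ : 1`! = 1)%N// (_ : 2`! = 2)%N//
  (_ : 3`! = 6)%N// (_ : 4`! = 24)%N//; lra.
Qed.

(** Amounts to e <= 3, from 1/e >= (1 - 1/6)^6 > 1/3. *)
Lemma ln_ge1 (l : nat) : (3 <= l)%N -> 1 <= ln l%:R :> R.
Proof.
move=> l3; have l0 : 0 < l%:R :> R by rewrite ltr0n (leq_trans _ l3).
rewrite -ler_expR lnK ?posrE//; apply: (@le_trans _ _ 3); last by rewrite ler_nat.
have h : 5 / 6 <= expR (- (1 / 6)) :> R by apply: le_trans (expR_ge1Dx _); lra.
have : (5 / 6) ^+ 6 <= expR (- (1 / 6)) ^+ 6 :> R.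
  by apply: lerXn2r; rewrite ?nnegrE ?expR_ge0//; lra.
rewrite -expRM_natl (_ : 6 * _ = - 1); last by field.
rewrite expRN => h6; have h3 : 3^-1 <= (expR 1)^-1 :> R by lra.
by rewrite -[leLHS]invrK -[leRHS]invrK lef_pV2 ?posrE ?invr_gt0 ?expR_gt0.
Qed.

Lemma sqrt_le_expR (z t : R) : z <= expR t -> Num.sqrt z <= expR (t / 2).
Proof.
move=> zt; have -> : expR (t / 2) = Num.sqrt (expR t).
  rewrite -[LHS]ger0_norm ?expR_ge0// -sqrtr_sqr -expRM_natl.
  by congr (Num.sqrt (expR _)); field.
by rewrite ler_sqrt// expR_ge0.
Qed.

Lemma exprn_le_expR (z t : R) (n : nat) : 0 <= z -> z <= expR t ->
  z ^+ n <= expR (n%:R * t).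
Proof. by move=> z0 zt; rewrite expRM_natl; apply: lerXn2r; rewrite ?nnegrE ?expR_ge0. Qed.

(** The bound 1 - v <= exp(- v) is applied to half the exponent and squared; at the full exponent
    the term in x^2 would have the wrong sign. *)
Lemma expR_le_1D (x : R) : 0 <= x <= 1 -> expR (x - 3 / 4 * x ^+ 2) <= 1 + x.
Proof.
move=> /andP[x0 x1]; pose v := x / 2 - 3 / 8 * x ^+ 2.
have v1 : 0 < 1 - v by rewrite /v; nra.
have -> : x - 3 / 4 * x ^+ 2 = - (2 * - v) by rewrite /v; field.
rewrite expRN expRM_natl -[leRHS]invrK lef_pV2 ?posrE ?exprn_gt0 ?expR_gt0 ?invr_gt0//; last lra.
have h : 1 - v <= expR (- v) by exact: expR_ge1Dx.
apply: (@le_trans _ _ ((1 - v) ^+ 2)); last by rewrite ler_sqr ?nnegrE ?expR_ge0 ?(ltW v1).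
rewrite -[leLHS]mul1r ler_pdivrMr; last by lra.
rewrite -subr_ge0 (_ : _ - _ = x ^+ 3 * (5 / 8 - 15 / 64 * x) + 9 / 64 * x ^+ 5).
  by rewrite addr_ge0// mulr_ge0 ?exprn_ge0//; lra.
by rewrite /v; field.
Qed.

(** (1 - x) (1 + x + 3 x^2 / 2) = 1 + x^2 (1 - 3 x) / 2, whence the range x <= 1/3. *)
Lemma inv_1B_le_expR (x : R) : 0 <= x <= 3^-1 ->
  (1 - x)^-1 <= expR (x + 3 / 2 * x ^+ 2).
Proof.
move=> /andP[x0 x1]; apply: le_trans (expR_ge1Dx _).
have x1' : 0 < 1 - x by lra.
rewrite -[leLHS]mul1r ler_pdivrMr//; nra.
Qed.

(** In each row, every direction of U contributes sqrt(1 + 2 lam) and cancels one of the [d] factors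
    1 / sqrt(1 + 2 lam). With ln(1 + x) >= x - 3 x^2 / 4 the exponent per row is at most - lam + 3 d
    lam^2 / 2, minimal at lam = 1 / (3 d) with value - 1 / (6 d). *)
Lemma tail_projection (s d k m : nat) (lam : R) :
  (0 < d)%N -> (m <= k)%N -> (k <= d)%N -> lam = (3 * d%:R)^-1 ->
  expR (lam * s%:R * (d%:R - k%:R - 1)) * (Num.sqrt (1 - 2 * - lam)^-1 ^+ (s * d)
    * Num.sqrt (1 - 2 * (1 - 2 * - lam)^-1 * lam)^-1 ^+ (s * m))
  <= expR (- (s%:R / (6 * d%:R))).
Proof.
move=> d0 mk kd lamE.
have d1 : 1 <= d%:R :> R by rewrite ler1n.
have dp : 0 < d%:R :> R by lra.
have lam0 : 0 < lam by rewrite lamE invr_gt0; lra.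
have lam1 : lam <= 3^-1 by rewrite lamE lef_pV2 ?posrE; lra.
rewrite (_ : 1 - 2 * - lam = 1 + 2 * lam); last by ring.
rewrite (_ : (1 - 2 * (1 + 2 * lam)^-1 * lam)^-1 = 1 + 2 * lam); last first.
  rewrite -[RHS]invrK; congr (_^-1); field; lra.
set x := 2 * lam; have x01 : 0 <= x <= 1 by rewrite /x; lra.
rewrite sqrtrV; last by lra.
set y := Num.sqrt (1 + x).
have y1 : 1 <= y by rewrite -sqrtr1 ler_sqrt; lra.
have y0 : 0 < y by lra.
have yV : y^-1 <= expR (- ((x - 3 / 4 * x ^+ 2) / 2)).
  rewrite expRN lef_pV2 ?posrE ?expR_gt0//.
  rewrite -[leLHS]ger0_norm ?expR_ge0// -sqrtr_sqr -expRM_natl.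
  rewrite (_ : 2 * _ = x - 3 / 4 * x ^+ 2); last by field.
  by rewrite /y ler_sqrt ?expR_le_1D//; lra.
have prodE : y^-1 ^+ (s * d) * y ^+ (s * m) <= y^-1 ^+ (s * (d - k)).
  rewrite -{1}(subnK kd) mulnDr exprD -mulrA ler_piMr ?exprn_ge0 ?invr_ge0 ?(ltW y0)//.
  apply: (@le_trans _ _ (y^-1 ^+ (s * k) * y ^+ (s * k))).
    rewrite ler_wpM2l ?exprn_ge0 ?invr_ge0 ?(ltW y0)//.
    by apply: ler_weXn2l => //; rewrite leq_mul2l mk orbT.
  by rewrite -exprMn mulVf ?gt_eqF// expr1n.
apply: (@le_trans _ _ (expR (lam * s%:R * (d%:R - k%:R - 1)) *
    expR ((s * (d - k))%:R * - ((x - 3 / 4 * x ^+ 2) / 2)))).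
  rewrite ler_wpM2l ?expR_ge0// (le_trans prodE)//.
  by apply: exprn_le_expR => //; rewrite invr_ge0 ltW.
rewrite -expRD ler_expR natrM natrB//.
have -> : s%:R / (6 * d%:R) = s%:R * (lam / 2) :> R.
  by rewrite lamE; field; rewrite gt_eqF.
have dl : d%:R * lam = 3^-1 by rewrite lamE; field; rewrite gt_eqF.
rewrite -subr_ge0 /x.
have -> : - (s%:R * (lam / 2)) - (lam * s%:R * (d%:R - k%:R - 1) +
    s%:R * (d%:R - k%:R) * - ((2 * lam - 3 / 4 * (2 * lam) ^+ 2) / 2)) =
    s%:R * lam * (2^-1 - 3 / 2 * (d%:R * lam) + 3 / 2 * (k%:R * lam)) by field.
by rewrite dl mulr_ge0 ?mulr_ge0 ?(ltW lam0)// addr_ge0 ?mulr_ge0 ?(ltW lam0)//; lra.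
Qed.

(** Along a unit direction the mean of exp(g^2 / 4) is sqrt 2 <= exp(139 / 400), once per row. *)
Lemma tail_net (s d : nat) (a : R) :
  expR (- (a * s%:R / 4)) * (Num.sqrt (1 - 2 * 0)^-1 ^+ (s * d)
    * Num.sqrt (1 - 2 * (1 - 2 * 0)^-1 * 4^-1)^-1 ^+ (s * 1))
  <= expR (s%:R * (139 / 400 - a / 4)).
Proof.
rewrite mulr0 subr0 invr1 sqrtr1 expr1n mul1r mulr1 muln1.
rewrite (_ : (1 - 2 / 4)^-1 = 2); last by field.
have h : Num.sqrt 2 ^+ s <= expR (s%:R * (139 / 200 / 2)) :> R.
  by apply: exprn_le_expR; [exact: sqrtr_ge0|apply: sqrt_le_expR; exact: two_le_expR].
apply: le_trans (ler_wpM2l (expR_ge0 _) h) _.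
by rewrite -expRD ler_expR le_eqVlt; apply/orP; left; apply/eqP; field.
Qed.

(** The exponent is at most n (- a + 3 d a^2), minimal at a = 1 / (6 d), where it equals - n / (12
    d). *)
Lemma tail_norm (n d : nat) (a : R) : (0 < d)%N -> a = (6 * d%:R)^-1 ->
  expR (- (a * (n%:R * (d%:R + 1)))) * (Num.sqrt (1 - 2 * a)^-1 ^+ (n * d)
    * Num.sqrt (1 - 2 * (1 - 2 * a)^-1 * 0)^-1 ^+ (n * 0))
  <= expR (- (n%:R / (16 * d%:R))).
Proof.
move=> d0 aE.
have d1 : 1 <= d%:R :> R by rewrite ler1n.
have dp : 0 < d%:R :> R by lra.
have a0 : 0 < a by rewrite aE invr_gt0; lra.
have a1 : a <= 6^-1 by rewrite aE lef_pV2 ?posrE; lra.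
rewrite muln0 expr0 mulr1.
have h : Num.sqrt (1 - 2 * a)^-1 ^+ (n * d) <=
    expR ((n * d)%:R * ((2 * a + 3 / 2 * (2 * a) ^+ 2) / 2)).
  apply: exprn_le_expR; first exact: sqrtr_ge0.
  by apply: sqrt_le_expR; apply: inv_1B_le_expR; lra.
apply: le_trans (ler_wpM2l (expR_ge0 _) h) _.
rewrite -expRD ler_expR natrM.
have -> : n%:R / (16 * d%:R) = n%:R * (3 / 8 * a) :> R.
  by rewrite aE; field; rewrite gt_eqF.
have da : d%:R * a = 6^-1 by rewrite aE; field; rewrite gt_eqF.
rewrite -subr_ge0.
have -> : - (n%:R * (3 / 8 * a)) - (- (a * (n%:R * (d%:R + 1))) +
    n%:R * d%:R * ((2 * a + 3 / 2 * (2 * a) ^+ 2) / 2)) =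
    n%:R * a * (5 / 8 - 3 * (d%:R * a)) by field.
by rewrite da mulr_ge0 ?mulr_ge0 ?(ltW a0)//; lra.
Qed.

Lemma union_projection (s d l : nat) : (0 < d)%N -> (3 <= l)%N ->
  54 * d%:R * ln (l%:R : R) <= s%:R ->
  l%:R * expR (- (s%:R / (6 * d%:R))) <= expR (- (s%:R / (8 * d%:R))) :> R.
Proof.
move=> d0 l3 sd; have l0 : 0 < l%:R :> R by rewrite ltr0n (leq_trans _ l3).
have dp : 0 < d%:R :> R by rewrite ltr0n.
have L1 := ln_ge1 l3.
rewrite -{1}(lnK l0) -expRD ler_expR.
have -> : s%:R / (6 * d%:R) = (s%:R / d%:R) / 6 :> R by field; rewrite gt_eqF.
have -> : s%:R / (8 * d%:R) = (s%:R / d%:R) / 8 :> R by field; rewrite gt_eqF.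
have : 54 * ln (l%:R : R) <= s%:R / d%:R by rewrite ler_pdivlMr// mulrAC.
lra.
Qed.

(** From 2 51 <= 2^7 the net has at most exp(5.865 d) points. With s >= 54 d and s >= 324 ln l, net
    and samples together cost at most 0.1117 s in the exponent; the tail gains 0.1327 s, and the
    difference 0.0210 s exceeds s / 54. *)
Lemma union_net (s d l : nat) : (6 <= d)%N -> (3 <= l)%N ->
  54 * d%:R * ln (l%:R : R) <= s%:R ->
  l%:R * (#|@net R d 50|%:R * expR (s%:R * (139 / 400 - 2 * (49 / 50) ^+ 2 / 4)))
  <= expR (- (s%:R / 54)) :> R.
Proof.
move=> d6 l3 sd; have l0 : 0 < l%:R :> R by rewrite ltr0n (leq_trans _ l3).
have d6R : 6 <= d%:R :> R by rewrite ler_nat.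
have L1 := ln_ge1 l3.
have net_le : #|@net R d 50|%:R <= expR (d%:R * (1 + 7 * (139 / 200))) :> R.
  apply: le_trans (card_net_le d (isT : (1 < 50)%N)) _.
  rewrite [d%:R * _]mulrDr [d%:R * 1]mulr1 expRD ler_wpM2l ?expR_ge0//.
  apply: exprn_le_expR => //.
  apply: (@le_trans _ _ (2 ^+ 7)); first by lra.
  by rewrite expRM_natl; apply: lerXn2r; rewrite ?nnegrE ?expR_ge0 ?two_le_expR.
apply: (@le_trans _ _ (expR (ln l%:R) * (expR (d%:R * (1 + 7 * (139 / 200))) *
    expR (s%:R * (139 / 400 - 2 * (49 / 50) ^+ 2 / 4))))).
  by rewrite lnK// ler_wpM2l ?(ltW l0)// ler_wpM2r ?expR_ge0.
rewrite -!expRD ler_expR; set L := ln _ in sd L1 *.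
have h1 : 324 * L <= s%:R by nra.
have h2 : 54 * d%:R <= s%:R :> R by nra.
lra.
Qed.

Lemma powR_inv_ge (d l : nat) (eps : R) : (0 < d)%N -> (0 < l)%N -> 0 < eps ->
  d%:R * ln eps^-1 <= l%:R -> 1 - d%:R^-1 <= eps `^ l%:R^-1.
Proof.
move=> d0 l0 eps0 h.
have lp : 0 < l%:R :> R by rewrite ltr0n.
have dp : 0 < d%:R :> R by rewrite ltr0n.
rewrite /powR (gt_eqF eps0) (le_trans (expR_ge1Dx _))// ler_expR.
move: h; rewrite lnV ?posrE// mulrN => h.
by rewrite ler_pdivlMl// mulrN lerNl ler_pdivlMr// mulNr mulrC.
Qed.

End numeric_bounds.

(** * The Gaussian mixture model *)

Section union_bound.
Context {R : realType} {dT : measure_display} {Omega : measurableType dT}.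
Variable P : probability Omega R.

Lemma pr_union_bound (I : finType) (A : set Omega) (B : I -> set Omega) :
  measurable A -> (forall i, measurable (B i)) -> A `<=` \bigcup_i B i ->
  fine (P A) <= \sum_i fine (P (B i)).
Proof.
move=> mA mB AB; rewrite -lee_fin fineK ?fin_num_measure//.
rewrite -sumEFin; under eq_bigr do rewrite fineK ?fin_num_measure//.
rewrite fsbig_seq ?index_enum_uniq//; apply: content_sub_fsum => //.
move=> x /AB[i _ Bi]; exists i => //=; exact: mem_index_enum.
Qed.

Lemma pr_union_bound2 (A B1 B2 : set Omega) :
  measurable A -> measurable B1 -> measurable B2 -> A `<=` B1 `|` B2 ->
  fine (P A) <= fine (P B1) + fine (P B2).
Proof.
move=> mA m1 m2 AB; rewrite -lee_fin EFinD !fineK ?fin_num_measure//.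
apply: le_trans (measureU2 _ m1 m2); apply: le_measure; rewrite ?inE//.
exact: measurableU.
Qed.

End union_bound.

Section model.
Context {R : realType} {dT : measure_display} {Omega : measurableType dT}.
Variables (P : probability Omega R) (n d k s l : nat).
Variables (mu : 'I_k -> 'rV[R]_d) (T : 'I_n -> Omega -> 'I_k).
Variables (Z : 'I_n -> 'I_d -> Omega -> R) (W : Omega -> samples n s l).
Hypothesis model : gmm_procedure_model P T Z W.

(** Taking [v] to be the identity gives the noise of the whole data set, [v] = w i that of the i-th
    sample. *)
Definition noise_rows (q : nat) (v : 'I_q -> 'I_n) (p : 'I_q * 'I_d) : Omega -> R :=
  Z (v p.1) p.2.

Local Notation N v := (noise_mx (noise_rows v)).
Local Notation inet := (@net R d 50).

Let mW w : measurable (W @^-1` [set w]).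
Proof. by case: model => _ [_ []]. Qed.

Let mZ (q : nat) (v : 'I_q -> 'I_n) p : measurable_fun setT (noise_rows v p).
Proof. by case: model => _ [] + _; exact. Qed.

(** Injectivity of [v] is where sampling without replacement enters: distinct sample positions read
    distinct noise rows. In the rectangles of the model, the labels and the rows outside the image
    of [v] are left unconstrained. *)
Lemma noise_rows_indep (q : nat) (v : 'I_q -> 'I_n) (w : samples n s l) :
  injective v -> forall A : 'I_q * 'I_d -> set R, (forall p, measurable (A p)) ->
  P (W @^-1` [set w] `&` \bigcap_p (noise_rows v p @^-1` A p))
  = (fine (P (W @^-1` [set w])) * \prod_p fine (normal_prob 0 1 (A p)))%:E.
Proof.
move=> vi A mA; case: model => _ [mZ0 [_ [_ [PZ [_ ind]]]]].
pose A0 (i : 'I_n) (j : 'I_d) : set R :=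
  if [pick r | v r == i] is Some r then A (r, j) else setT.
have A0v r j : A0 (v r) j = A (r, j).
  rewrite /A0; case: pickP => [r' /eqP/vi -> //|/(_ r)].
  by rewrite eqxx.
have mA0 i j : measurable (A0 i j) by rewrite /A0; case: pickP.
have prZ i j : pr P (Z i j @^-1` A0 i j) = fine (normal_prob 0 1 (A0 i j)).
  by rewrite /pr PZ.
have := ind (fun=> setT) A0 [set w] mA0.
rewrite [\prod_(i < n) pr P (_ @^-1` setT)]big1 ?mul1r; last first.
  by move=> i _; rewrite /pr preimage_setT probability_setT.
have -> : \prod_(i < n) \prod_(j < d) pr P (Z i j @^-1` A0 i j) =
    \prod_p fine (normal_prob 0 1 (A p)) :> R.
  transitivity (\prod_(i < n) \prod_(j < d) fine (normal_prob 0 1 (A0 i j)) : R).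
    by do 2 apply: eq_bigr => ? _; exact: prZ.
  rewrite (bigID (mem (v @: [set: 'I_q]%SET)))/= [X in _ * X]big1 ?mulr1; last first.
    move=> i iv; rewrite big1// => j _; rewrite /A0; case: pickP => [r /eqP vr|_].
      by case/negP: iv; rewrite -vr; apply: imset_f; rewrite inE.
    by rewrite [normal_prob _ _ _](@probability_setT _ _ _ (normal_prob 0 1)).
  rewrite big_imset/=; last by move=> x y _ _; exact: vi.
  transitivity (\prod_r \prod_j fine (normal_prob 0 1 (A (r, j))) : R).
    apply: eq_big => r; first by rewrite inE.
    by move=> _; apply: eq_bigr => j _; rewrite A0v.
  by rewrite pair_big/=; apply: eq_bigr => -[].
rewrite [RHS]mulrC => e.
rewrite -/(pr P (W @^-1` [set w])) -e /pr fineK.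
  congr (P _); apply/seteqP; split => x.
  - move=> [/= xw xA]; split=> //; split.
      by rewrite -bigcap_seq => i _.
    rewrite -bigcap_seq => i _; rewrite -bigcap_seq => j _ /=.
    rewrite /A0; case: pickP => // r /eqP vr.
    by have := xA (r, j) I; rewrite /noise_rows/= vr.
  - move=> [[_ xA] xw]; split=> // -[r j] _.
    move: xA; rewrite -bigcap_seq => /(_ (v r)).
    rewrite /= mem_index_enum -bigcap_seq => /(_ isT j).
    by rewrite /= mem_index_enum A0v; exact.
apply: fin_num_measure; apply: measurableI; last exact: mW.
apply: measurableI.
  rewrite -bigcap_seq; apply: fin_bigcap_measurable => // i _.
  by rewrite preimage_setT.
rewrite -bigcap_seq; apply: fin_bigcap_measurable => // i _.
rewrite -bigcap_seq; apply: fin_bigcap_measurable => // j _.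
by rewrite -[X in measurable X]setTI; apply: mZ0.
Qed.

Section bad_events.
Variables (m : nat) (U : 'M[R]_(m, d)).

(* Each event is stated as [noise_chernoff] bounds it: both sides carry the
   Chernoff parameter, 1/(6d), 1/(3d) and 1/4 respectively.  In [bad_direction]
   the constant is 2 (1 - 1/50)^2, so that a net of mesh 1/50 gives operator norm
   at most sqrt (2 s). *)
Definition no_rows : 'M[R]_(0, d) := 0.

Definition bad_norm : set Omega :=
  [set om | (6 * d%:R)^-1 * (n%:R * (d%:R + 1))
    <= (6 * d%:R)^-1 * \tr (N id om *m (N id om)^T)
       + 0 * \tr (N id om *m no_rows^T *m (N id om *m no_rows^T)^T)].

Definition bad_projection (v : 'I_s -> 'I_n) : set Omega :=
  [set om | - ((3 * d%:R)^-1 * s%:R * (d%:R - k%:R - 1))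
    <= - (3 * d%:R)^-1 * \tr (N v om *m (N v om)^T)
       + (3 * d%:R)^-1 * \tr (N v om *m U^T *m (N v om *m U^T)^T)].

Definition bad_direction (v : 'I_s -> 'I_n) (e : 'rV[R]_d) : set Omega :=
  [set om | 2 * (49 / 50) ^+ 2 * s%:R / 4
    <= 0 * \tr (N v om *m (N v om)^T)
       + 4^-1 * \tr (N v om *m e^T *m (N v om *m e^T)^T)].

(** Net points are normalised because the moment formula needs unit vectors. Codes outside the net
    and the zero vector get the empty event, so that unions run over the whole finite type. *)
Definition bad_net (v : 'I_s -> 'I_n)
    (z : {ffun 'I_d -> bool * 'I_(50 * d).+1}) : set Omega :=
  if inet z && (sqnorm (net_pt z) != 0 :> R)
  then bad_direction v ((Num.sqrt (sqnorm (net_pt z)))^-1 *: net_pt z)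
  else set0.

Lemma measurable_bad_norm : measurable bad_norm.
Proof. exact: measurable_noise. Qed.

Lemma measurable_bad_projection v : measurable (bad_projection v).
Proof. exact: measurable_noise. Qed.

Lemma measurable_bad_net v z : measurable (bad_net v z).
Proof. by rewrite /bad_net; case: ifP => // _; exact: measurable_noise. Qed.

Lemma pr_bad_norm (w : samples n s l) : (0 < d)%N ->
  fine (P (W @^-1` [set w] `&` bad_norm))
  <= fine (P (W @^-1` [set w])) * expR (- (n%:R / (16 * d%:R))).
Proof.
move=> d0; have d1 : 1 <= d%:R :> R by rewrite ler1n.
have a6 : (6 * d%:R)^-1 <= 6^-1 :> R by rewrite lef_pV2 ?posrE; lra.
apply: (le_trans (@noise_chernoff _ _ _ P _ _ _ _ (mZ id) (mW w)
  (noise_rows_indep w (@inj_id _)) 0 0 _ _ _ _ _ _ _)).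
- by apply/matrixP => -[].
- lra.
- by [].
- lra.
- by rewrite ler_wpM2l ?fine_ge0//; exact: tail_norm.
Qed.

Lemma pr_bad_projection (w : samples n s l) (v : 'I_s -> 'I_n) :
  injective v -> (0 < d)%N -> (m <= k)%N -> (k <= d)%N -> U *m U^T = 1%:M ->
  fine (P (W @^-1` [set w] `&` bad_projection v))
  <= fine (P (W @^-1` [set w])) * expR (- (s%:R / (6 * d%:R))).
Proof.
move=> vi d0 mk kd UU; have d1 : 1 <= d%:R :> R by rewrite ler1n.
have lam0 : 0 < (3 * d%:R)^-1 :> R by rewrite invr_gt0; lra.
apply: (le_trans (@noise_chernoff _ _ _ P _ _ _ _ (mZ v) (mW w)
  (noise_rows_indep w vi) _ _ _ _ _ UU _ _ _)).
- lra.
- exact: ltW.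
- lra.
- by rewrite opprK ler_wpM2l ?fine_ge0//; exact: tail_projection.
Qed.

Lemma pr_bad_net (w : samples n s l) (v : 'I_s -> 'I_n) z : injective v ->
  fine (P (W @^-1` [set w] `&` bad_net v z))
  <= fine (P (W @^-1` [set w])) * ((inet z)%:R *
       expR (s%:R * (139 / 400 - 2 * (49 / 50) ^+ 2 / 4))).
Proof.
move=> vi; rewrite /bad_net; case: (boolP (inet z)) => /= [_|_]; last first.
  by rewrite setI0 measure0 mul0r mulr0.
rewrite mul1r; have [e0|e0] := eqVneq (sqnorm _) 0.
  by rewrite setI0 measure0 mulr_ge0 ?fine_ge0 ?expR_ge0.
set e := _ *: _.
have ee : e *m e^T = 1%:M.
  rewrite [LHS]mx11_scalar -sqnormE /e sqnormZ exprVn sqr_sqrtr ?sqnorm_ge0//.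
  by rewrite mulVf.
apply: (le_trans (@noise_chernoff _ _ _ P _ _ _ _ (mZ v) (mW w)
  (noise_rows_indep w vi) _ _ _ _ _ ee _ _ _)).
- lra.
- lra.
- lra.
- by rewrite ler_wpM2l ?fine_ge0//; exact: tail_net.
Qed.

Lemma good_SDP_ge (om : Omega) (v : 'I_s -> 'I_n) :
  (0 < d)%N -> (0 < k)%N -> (k <= s)%N -> U *m U^T = 1%:M ->
  (\matrix_t mu t) *m U^T *m U = \matrix_t mu t ->
  ~ bad_projection v om -> (forall z, ~ bad_net v z om) ->
  d%:R - 3 * k%:R - 1 <= SDP (gmm_points mu T Z om \o v) k.
Proof.
move=> d0 k0 ks UU muU /negP gp gn.
have d1 : 1 <= d%:R :> R by rewrite ler1n.
have lam0 : 0 < (3 * d%:R)^-1 :> R by rewrite invr_gt0; lra.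
have s0 : 0 < s%:R :> R by rewrite ltr0n (leq_trans k0).
(* The net lives in dimension [d], so it controls the transpose of the noise; [opnorm_tr] passes to
   vectors of dimension [s], the side on which [Z] acts. *)
have N_op u : sqnorm (u *m N v om) <= 2 * s%:R * sqnorm u.
  apply: opnorm_tr; first by rewrite mulr_gt0.
  move=> {}u; have := @net_opnorm R d 50 d0 isT s (N v om)^T
    (2 * (49 / 50) ^+ 2 * s%:R) _ u.
  rewrite (_ : 2 * _ ^+ 2 * s%:R / _ = 2 * s%:R); last by field.
  apply => z nz; have [e0|e0] := eqVneq (sqnorm (net_pt z : 'rV[R]_d)) 0.
    rewrite (sqnorm0_eq e0) mul0mx; apply: (@le_trans _ _ 0).
      by rewrite /sqnorm big1// => j _; rewrite mxE expr0n.
    by rewrite !mulr_ge0.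
  have := gn z; rewrite /bad_net nz e0 /= => /negP; rewrite -ltNge mul0r add0r.
  set e := _ *: _.
  have -> : \tr (N v om *m e^T *m (N v om *m e^T)^T) =
      (sqnorm (net_pt z))^-1 * sqnorm (net_pt z *m (N v om)^T).
    rewrite mxtrace_mulC trmx_mul !trmxK [\tr _]big_ord1.
    have -> : N v om *m e^T = (e *m (N v om)^T)^T by rewrite trmx_mul trmxK.
    rewrite -sqnormE /e -scalemxAl sqnormZ exprVn sqr_sqrtr ?sqnorm_ge0//.
  have epos : 0 < sqnorm (net_pt z : 'rV[R]_d) by rewrite lt_def e0 sqnorm_ge0.
  (* The event concerns the normalised net point; as net points lie in the unit ball, the bound
     holds for the point itself. *)
  have : sqnorm (net_pt z : 'rV[R]_d) <= 1 by case/andP: nz.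
  set x := sqnorm _ in epos *; set y := sqnorm (_ *m _) => x1 h.
  have : x^-1 * y < 2 * (49 / 50) ^+ 2 * s%:R by lra.
  rewrite ltr_pdivrMl// => /ltW/le_trans; apply.
  by rewrite ler_piMl// !mulr_ge0.
pose M : 'M[R]_(s, d) := \matrix_r mu (T (v r) om).
have YE : points_mx (gmm_points mu T Z om \o v) = M + N v om.
  by apply/matrixP => r j; rewrite !mxE.
have MU : M *m U^T *m U = M.
  apply/row_matrixP => r; rewrite !row_mul rowK.
  have -> : mu (T (v r) om) = row (T (v r) om) (\matrix_t mu t) by rewrite rowK.
  by rewrite -!row_mul muU.
apply: le_trans (SDP_ge_noise k0 ks YE UU MU N_op).
(* Divided by the Chernoff parameter, the complement of [bad_projection] reads |N|_F^2 - |N U^T|_F^2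
   > s (d - k - 1); the operator norm then takes 2 s k. *)
rewrite ler_pdivlMl//; move: gp; rewrite /bad_projection/= -ltNge.
set A := \tr _; set B := \tr _; rewrite -mulrA -mulrN mulNr -mulrN -mulrDr ltr_pM2l// => h.
rewrite !mulrBr mulr1; move: h; rewrite !mulrBr mulr1.
lra.
Qed.

(** Clustering by the hidden labels around the true centres leaves exactly the noise; labels that do
    not occur are covered by refinement. *)
Lemma good_IP_le (om : Omega) : (0 < d)%N -> (0 < n)%N -> (k <= n)%N ->
  ~ bad_norm om -> IP (gmm_points mu T Z om) k <= d%:R + 1.
Proof.
move=> d0 n0 kn /negP; have d1 : 1 <= d%:R :> R by rewrite ler1n.
have a0 : 0 < (6 * d%:R)^-1 :> R by rewrite invr_gt0; lra.
have np : 0 < n%:R :> R by rewrite ltr0n.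
rewrite /bad_norm/= -ltNge mul0r addr0 ltr_pM2l// => h.
apply: le_trans (IP_le_labelling _ (fun i => T i om) mu kn) _.
rewrite ler_pdivrMl//; apply: le_trans (ltW h).
rewrite mxtrace_mul_tr; apply: ler_sum => i _.
rewrite /sqnorm; apply: ler_sum => j _.
by rewrite /gmm_points addrC addKr !mxE.
Qed.

Hypotheses (kd : (k <= d)%N) (ds : (d <= s)%N) (sn : (s <= n)%N).
Hypotheses (k0 : (0 < k)%N) (l3 : (3 <= l)%N) (d6 : (6 <= d)%N).
Hypothesis mk : (m <= k)%N.
Hypothesis UU : U *m U^T = 1%:M.
Hypothesis sL : 54 * d%:R * ln (l%:R : R) <= s%:R.

Definition bad_sample (w : samples n s l) : set Omega :=
  bad_norm `|` (\bigcup_i bad_projection (w i) `|`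
                \bigcup_(p : 'I_l * {ffun 'I_d -> bool * 'I_(50 * d).+1})
                  bad_net (w p.1) p.2).

(** On each piece {W = w} the samples are fixed injections. The union is the measurable event that
    witnesses part (b). *)
Definition good_event : set Omega :=
  \bigcup_(w in [set w | valid_sample w]) (W @^-1` [set w] `\` bad_sample w).

Lemma measurable_bad_sample w : measurable (bad_sample w).
Proof.
apply: measurableU; first exact: measurable_bad_norm.
apply: measurableU.
  apply: fin_bigcup_measurable => [|i _]; first exact: finite_finset.
  exact: measurable_bad_projection.
apply: fin_bigcup_measurable => [|p _]; first exact: finite_finset.
exact: measurable_bad_net.
Qed.

Lemma measurable_good_event : measurable good_event.
Proof.
apply: fin_bigcup_measurable => [|w _]; first exact: finite_finset.
apply: measurableD; first exact: mW.
exact: measurable_bad_sample.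
Qed.

(** A union bound within {W = w}: the factor P(W = w) is common to all three kinds of events, so
    their tails add as conditional probabilities. *)
Lemma pr_bad_sample (w : samples n s l) : valid_sample w ->
  fine (P (W @^-1` [set w] `&` bad_sample w)) <= fine (P (W @^-1` [set w])) *
    (expR (- (n%:R / (16 * d%:R))) + (expR (- (s%:R / (8 * d%:R)))
     + expR (- (s%:R / 54)))).
Proof.
move=> vw; have d0 : (0 < d)%N by exact: leq_trans d6.
have wi i : injective (w i) by apply/injectiveP; exact: (forallP vw i).
set C := W @^-1` [set w]; have mC : measurable C by exact: mW.
have mN : measurable (C `&` bad_norm).
  by apply: measurableI => //; exact: measurable_bad_norm.
have mP i : measurable (C `&` bad_projection (w i)).
  by apply: measurableI => //; exact: measurable_bad_projection.
have mB (p : 'I_l * {ffun 'I_d -> bool * 'I_(50 * d).+1}) :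
    measurable (C `&` bad_net (w p.1) p.2).
  by apply: measurableI => //; exact: measurable_bad_net.
have mPU : measurable (\bigcup_i (C `&` bad_projection (w i))).
  by apply: fin_bigcup_measurable => //; exact: finite_finset.
have mBU : measurable (\bigcup_(p : 'I_l * {ffun 'I_d -> bool * 'I_(50 * d).+1})
    (C `&` bad_net (w p.1) p.2)).
  by apply: fin_bigcup_measurable => //; exact: finite_finset.
have hP : fine (P (\bigcup_i (C `&` bad_projection (w i)))) <=
    fine (P C) * expR (- (s%:R / (8 * d%:R))).
  apply: le_trans (pr_union_bound P mPU mP (@subset_refl _ _)) _.
  apply: (@le_trans _ _ (\sum_(i < l) fine (P C) * expR (- (s%:R / (6 * d%:R))))).
    by apply: ler_sum => i _; exact: pr_bad_projection.
  rewrite sumr_const card_ord -[_ *+ l]mulr_natl mulrCA ler_wpM2l ?fine_ge0//.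
  exact: union_projection.
have hB : fine (P (\bigcup_(p : 'I_l * {ffun 'I_d -> bool * 'I_(50 * d).+1})
    (C `&` bad_net (w p.1) p.2))) <= fine (P C) * expR (- (s%:R / 54)).
  apply: le_trans (pr_union_bound P mBU mB (@subset_refl _ _)) _.
  pose t : R := expR (s%:R * (139 / 400 - 2 * (49 / 50) ^+ 2 / 4)).
  apply: (@le_trans _ _ (\sum_(p : 'I_l * {ffun 'I_d -> bool * 'I_(50 * d).+1})
      fine (P C) * ((inet p.2)%:R * t))).
    by apply: ler_sum => p _; exact: pr_bad_net.
  rewrite -mulr_sumr ler_wpM2l ?fine_ge0// -mulr_suml.
  rewrite -(pair_bigA _ (fun (_ : 'I_l) z => (inet z)%:R))/=.
  rewrite sumr_const card_ord -[_ *+ l]mulr_natl -mulrA.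
  have -> : \sum_z (inet z)%:R = #|inet|%:R :> R.
    rewrite -sum1_card natr_sum [RHS]big_mkcond/=; apply: eq_bigr => z _.
    by rewrite (_ : (z \in inet) = inet z)//; case: (inet z).
  exact: union_net.
have h1 := pr_union_bound2 P (measurableI _ _ mC (measurable_bad_sample w)) mN
  (measurableU _ _ mPU mBU).
apply: le_trans (h1 _) _.
  move=> x [Cx [xn|[[i _ xi]|[p _ xp]]]]; first by left.
    by right; left; exists i.
  by right; right; exists p.
rewrite mulrDr lerD ?pr_bad_norm// mulrDr.
apply: le_trans (pr_union_bound2 P (measurableU _ _ mPU mBU) mPU mBU _) _ => //.
exact: lerD.
Qed.

Lemma pr_good_event :
  1 - expR (- (s%:R / (8 * d%:R))) - 2 * expR (- (s%:R / 54))
    - expR (- (n%:R / (16 * d%:R))) <= fine (P good_event).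
Proof.
set b := expR (- (n%:R / (16 * d%:R))) + (expR (- (s%:R / (8 * d%:R)))
     + expR (- (s%:R / 54))) : R.
suff h : fine (P (~` good_event)) <= b.
  have gE : fine (P (~` good_event)) = 1 - fine (P good_event).
    rewrite probability_setC; last exact: measurable_good_event.
    by rewrite fineB// fin_num_measure//; exact: measurable_good_event.
  (* [b] contains exp(- s / 54) once, the stated bound twice. *)
  have := expR_ge0 (- (s%:R / 54) : R); move: h; rewrite gE /b; lra.
have PW w : fine (P (W @^-1` [set w])) =
    if valid_sample w then (#|[set w' : samples n s l | valid_sample w']|%:R)^-1
    else 0 :> R.
  by case: model => _ [_ [_ [_ [_ [+ _]]]]]; exact.
have mE w : measurable (W @^-1` [set w] `\` good_event).
  by apply: measurableD => //; exact: measurable_good_event.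
apply: le_trans (@pr_union_bound _ _ _ P _ (~` good_event)
  (fun w => W @^-1` [set w] `\` good_event) _ mE _) _.
- by apply: measurableC; exact: measurable_good_event.
- by move=> x nx; exists (W x).
apply: (@le_trans _ _ (\sum_w fine (P (W @^-1` [set w])) * b)).
  apply: ler_sum => w _; case: (boolP (valid_sample w)) => vw.
    apply: le_trans (pr_bad_sample vw).
    rewrite fine_le ?fin_num_measure//.
    - by apply: measurableI => //; exact: measurable_bad_sample.
    - apply: le_measure; rewrite ?inE//.
        by apply: measurableI => //; exact: measurable_bad_sample.
      move=> x [xw ng]; split=> //; apply: contrapT => nb; apply: ng.
      by exists w.
  (* Invalid outcomes have probability 0, so their contribution vanishes. *)
  apply: (@le_trans _ _ (fine (P (W @^-1` [set w])))); last first.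
    by rewrite PW (negbTE vw) mul0r.
  rewrite fine_le ?fin_num_measure//.
  by apply: le_measure; rewrite ?inE// => x [].
rewrite -mulr_suml ler_piMl//.
  by rewrite /b !addr_ge0 ?expR_ge0.
under eq_bigr do rewrite PW.
rewrite -big_mkcond/= sumr_const -[leLHS]mulr_natl card_mkset.
rewrite mulfV// pnatr_eq0 -lt0n.
rewrite -card_mkset card_valid_sample expn_gt0.
by rewrite card_inj_gt0.
Qed.

End bad_events.
End model.

Theorem theorem5 (R : realType) :
  (* (a) *)
  (forall (n d : nat) (X : 'I_n -> 'rV[R]_d) (k s l : nat) (eps : R),
      (2 <= k)%N -> (k <= s)%N -> (s <= n)%N -> (1 <= l)%N -> 0 < eps ->
      1 - eps <= proc_prob (fun w : samples n s l => BM X k eps w <= IP X k))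
  /\
  (* (b) *)
  (forall (n d k : nat) (mu : 'I_k -> 'rV[R]_d) (s l : nat) (eps : R)
          (dT : measure_display) (Omega : measurableType dT)
          (P : probability Omega R)
          (T : 'I_n -> Omega -> 'I_k) (Z : 'I_n -> 'I_d -> Omega -> R)
          (W : Omega -> samples n s l),
      gmm_procedure_model P T Z W ->
      0 < eps -> (0 < k)%N ->
      (k <= d)%N -> (d <= s)%N -> (s <= n)%N ->
      54%:R * d%:R * ln (l%:R : R) <= s%:R ->
      d%:R * ln (eps^-1) <= l%:R ->
      (3 <= l)%N ->
      exists E : set Omega,
        [/\ measurable E,
            E `<=` [set om | (d%:R - 3%:R * k%:R - 2%:R) / (d%:R + 1)
                               * IP (gmm_points mu T Z om) k
                             <= BM (gmm_points mu T Z om) k eps (W om)] &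
            1 - expR (- (s%:R / (8%:R * d%:R))) - 2%:R * expR (- (s%:R / 54%:R))
              - expR (- (n%:R / (16%:R * d%:R)))
            <= pr P E]).
Proof.
split=> [n d X k s l eps k2 ks sn l1 eps0|].
  by apply: markov_bound => //; exact: leq_trans k2.
move=> n d k mu s l eps dT Omega P T Z W model eps0 k0 kd ds sn sL epsl l3.
have d0 : (0 < d)%N by exact: leq_trans kd.
have ks : (k <= s)%N by exact: leq_trans ds.
have l0 : (0 < l)%N by exact: leq_trans l3.
(* If d <= 3k + 2 the coefficient of [IP] is nonpositive, while [IP] and [BM] are nonnegative: the
   whole space serves as the event. *)
have [dk|dk] := leqP d (3 * k + 2).
  exists setT; split=> //.
    move=> om _ /=.
    have coef : (d%:R - 3%:R * k%:R - 2%:R) / (d%:R + 1) <= 0 :> R.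
      rewrite mulr_le0_ge0 ?invr_ge0 ?addr_ge0//.
      by move: dk; rewrite -(ler_nat R) natrD natrM; lra.
    apply: (@le_trans _ _ 0); first by rewrite mulr_le0_ge0 ?IP_ge0.
    rewrite -(mulr0 (eps `^ l%:R^-1)); apply: BM_ge => // i; exact: SDP_ge0.
  have := expR_ge0 (- (s%:R / (8 * d%:R)) : R).
  have := expR_ge0 (- (s%:R / 54) : R).
  have := expR_ge0 (- (n%:R / (16 * d%:R)) : R).
  rewrite /pr probability_setT/=; lra.
(* Since k >= 1, d > 3k + 2 gives d >= 6, from which [union_net] obtains s >= 324 ln l. *)
have d6 : (6 <= d)%N by move: dk k0; lia.
have [m [U [mk UU muU]]] := orthonormal_span (\matrix_t mu t).
exists (good_event k Z W U); split.
- exact: (measurable_good_event model).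
- move=> om [w /= vw [/= Ww /not_orP[gN /not_orP[gP gB]]]].
  set X := gmm_points mu T Z om.
  have IPle : IP X k <= d%:R + 1.
    apply: (good_IP_le mu T _ _ _ gN) => //.
      by rewrite (leq_trans d0)// (leq_trans ds).
    exact: leq_trans ks sn.
  have SDPge i : d%:R - 3 * k%:R - 1 <= SDP (subsample X (W om) i) k.
    rewrite Ww; apply: (good_SDP_ge T d0 k0 ks UU muU) => [bP|z bz].
      by apply: gP; exists i.
    by apply: gB; exists (i, z).
  have d1 : 1 <= d%:R :> R by rewrite ler1n.
  have dkR : 3 * k%:R + 3 <= d%:R :> R.
    by move: dk; rewrite -(ler_nat R) -natr1 natrD natrM; lra.
  have e1 := powR_inv_ge d0 l0 eps0 epsl.
  apply: le_trans (BM_ge eps l0 SDPge).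
  apply: (@le_trans _ _ (d%:R - 3 * k%:R - 2)).
    rewrite mulrAC ler_pdivrMr; last by lra.
    by rewrite ler_wpM2l//; lra.
  (* The product equals d - 3k - 2 + (3k + 1) / d, so the unit gained in the bound on [SDP] pays for
     the factor 1 - 1/d. *)
  apply: (@le_trans _ _ ((1 - d%:R^-1) * (d%:R - 3 * k%:R - 1))); last first.
    by rewrite ler_wpM2r//; lra.
  rewrite -subr_ge0.
  have -> : (1 - d%:R^-1) * (d%:R - 3 * k%:R - 1) - (d%:R - 3 * k%:R - 2) =
      (3 * k%:R + 1) / d%:R :> R by field; rewrite gt_eqF; lra.
  by rewrite divr_ge0// addr_ge0// mulr_ge0.
- exact: (pr_good_event model).
Qed.
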